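(* Let $\Phi_0=\Psi_0=0$ and let $L_E$ be the Lipschitz constant of $E$. Further assume $\tau$ to be sufficiently small such that $2\tau(1+T)\,C_{\mathbf S}\,L_E<1$ and that the filter functions are chosen such that $\|\mathbf S\|\le C_{\mathbf S}$. Then the error $e_n=\begin{pmatrix} q(t_n)-q_n\\ v(t_n)-v_n\end{pmatrix}$ of the approximation $(q_n,v_n)$ defined by the exponential integrator to the exact solution $(q,v)$ is bounded by $$\|e_n\|\le C\,\tau,\qquad 0\le t_n=n\tau\le T,$$ where $C=C(L_E,K,\mathbf S,T)$.
   Context: Setting. $B\in\mathbb R^3$ is a constant strong magnetic field, $\|B\|=1/\delta\gg1$, and $\mathbf B\in\mathbb R^{3\times 3}$ is the skew-symmetric matrix with $\mathbf B v=v\times B$ (eigenvalues $0,\pm i\|B\|$). $E:\mathbb R^3\to\mathbb R^3$ is the electric field and $(q,v)$ is the solution on $[0,T]$ of $$\dot q=v,\qquad \dot v=v\times B+E(q),\qquad q(0)=q_0,\ v(0)=v_0 .$$ Assumption: the trajectories of $q,v$ remain in compact sets $K_q,K_v$ independent of $\|B\|$, and $E\in C^1$ in a neighborhood of $K_q$. In the constant $C(L_E,K,\mathbf S,T)$, $K$ stands for the sets $K_q,K_v$. Integrator. For a stepsize $\tau>0$, $t_n=n\tau$, $E_n=E(q_n)$, the approximations $q_n\approx q(t_n)$, $v_n\approx v(t_n)$ start from $q_0,v_0$ and satisfy the (in general implicit) relations $$q_{n+1}=q_n+\tfrac\tau2\bigl(\psi_-(\tau\mathbf B)v_n+\psi_+(\tau\mathbf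 B)v_{n+1}\bigr)+\tfrac{\tau^2}4\bigl(\chi_-(\tau\mathbf B)E_n+\chi_+(\tau\mathbf B)E_{n+1}\bigr),$$ $$v_{n+1}=e^{\tau\mathbf B}v_n+\tfrac\tau2\bigl(\phi_-(\tau\mathbf B)E_n+\phi_+(\tau\mathbf B)E_{n+1}\bigr),$$ with given filter functions $\psi_\pm,\chi_\pm,\phi_\pm$ defined on the eigenvalues $0,\pm i\tau\|B\|$ of $\tau\mathbf B$. Notation. $\varphi_1(z)=\int_0^1e^{(1-\sigma)z}\,d\sigma$, $\operatorname{sinch}(z)=\sinh(z)/z$ (with $\operatorname{sinch}(0)=1$), $$\Phi_0(z)=\varphi_1(z)-\tfrac12\bigl(\phi_+(z)+\phi_-(z)\bigr),\qquad \Psi_0(z)=\operatorname{sinch}(\tfrac z2)-\tfrac12\bigl(\psi_-(z)+\psi_+(z)e^z\bigr)e^{-z/2},$$ $$\mathbf S=\tfrac12\begin{pmatrix}\tfrac\tau2\chi_-(\tau\mathbf B)&\tfrac\tau2\chi_+(\tau\mathbf B)\\ \phi_-(\tau\mathbf B)&\phi_+(\tau\mathbf B)\end{pmatrix}.$$ $\|\cdot\|$ is the Euclidean norm and the induced matrix norm.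
   Formalization: The claim fails when only S is bounded. The formal theorem also assumes ψ₊(τB), χ₋(τB), χ₊(τB) have norm at most a constant C_F, and τ‖ψ₊(τB)‖ ≤ 2(1+T); C may also depend on C_F and on a bound of E on K_q. *)

(* Defs.v *)
From HB Require Import structures.
From mathcomp Require Import all_boot all_order all_algebra.
From mathcomp Require Import all_classical all_reals all_analysis.
From mathcomp Require Import complex.

Set Implicit Arguments.
Unset Strict Implicit.
Unset Printing Implicit Defensive.

Import Order.TTheory GRing.Theory Num.Theory.
Import numFieldNormedType.Exports.

Local Open Scope classical_set_scope.
Local Open Scope complex_scope.
Local Open Scope sesquilinear_scope.
Local Open Scope ring_scope.

Section Norms.
Variable R : realType.

(* The library norm on matrices is the entrywise maximum, hence these
   Euclidean norms; the two choices induce the same topology. *)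
Definition l2norm n (x : 'cV[R]_n) : R :=
  Num.sqrt (\sum_(i < n) x i 0 ^+ 2).

Definition cl2norm n (x : 'cV[R[i]]_n) : R :=
  Num.sqrt (\sum_(i < n) ComplexField.Normc.normc (x i 0) ^+ 2).

Definition opnorm m n (A : 'M[R[i]]_(m, n)) : R :=
  sup [set cl2norm (A *m x) | x in [set x : 'cV[R[i]]_n | cl2norm x <= 1]].

Definition l2lipschitz n (L : R) (E : 'cV[R]_n -> 'cV[R]_n) :=
  forall x y, l2norm (E x - E y) <= L * l2norm (x - y).

(* In finite dimension, continuity of the derivative as an operator-valued map
   is continuity of [x |-> 'd E x u] for every fixed [u]. *)
Definition C1_near (n : nat) (K : set 'cV[R]_n.+1)
    (E : 'cV[R]_n.+1 -> 'cV[R]_n.+1) :=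
  exists U : set 'cV[R]_n.+1, [/\ open U, K `<=` U,
    forall x, U x -> differentiable E x &
    forall x, U x -> forall u : 'cV[R]_n.+1,
      {for x, continuous (fun y => ('d E y : _ -> _) u)}].

End Norms.

Section ComplexFunctions.
Variable R : realType.
Implicit Types z : R[i].

Definition cexp z : R[i] :=
  (expR (complex.Re z))%:C * (cos (complex.Im z) +i* sin (complex.Im z)).

Definition sinch z : R[i] :=
  if z == 0 then 1 else (cexp z - cexp (- z)) / 2 / z.

Definition varphi1 z : R[i] :=
  (\int[lebesgue_measure]_(s in `[0%R, 1%R]) complex.Re (cexp ((1 - s)%:C * z)))
  +i*
  (\int[lebesgue_measure]_(s in `[0%R, 1%R]) complex.Im (cexp ((1 - s)%:C * z))).

End ComplexFunctions.

(* [f(A)] for a normal matrix [A], through its unitary diagonalisation; it only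
   depends on the values of [f] on the spectrum of [A], and not on the choice
   made by [spectralmx]. *)
Definition mxfun (C : numClosedFieldType) n (f : C -> C) (A : 'M[C]_n) : 'M[C]_n :=
  invmx (spectralmx A) *m diag_mx (map_mx f (spectral_diag A)) *m spectralmx A.

Section MagneticField.
Variable R : realType.
Implicit Types u w B v : 'cV[R]_3.

(* Indices are taken modulo 3. *)
Definition crossv u w : 'cV[R]_3 :=
  \col_(i < 3) (u (i + 1) 0 * w (i + 2) 0 - u (i + 2) 0 * w (i + 1) 0).

Definition Bmx B : 'M[R]_3 :=
  \matrix_(i < 3, j < 3) crossv (delta_mx j 0) B i 0.

Definition toC m n (A : 'M[R]_(m, n)) : 'M[R[i]]_(m, n) :=
  map_mx (real_complex R) A.

Definition tauB (tau : R) B : 'M[R[i]]_3 := toC (tau *: Bmx B).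

Lemma BmxE B v : Bmx B *m v = crossv v B.
Proof.
have sumd (k : 'I_3) (b : R) :
    \sum_(j < 3) ((k == j)%:R * b) * v j 0 = v k 0 * b.
  rewrite (bigD1 k) //= eqxx mul1r mulrC big1 ?addr0 // => j.
  by rewrite eq_sym => /negbTE ->; rewrite !mul0r.
apply/colP => i; rewrite !mxE -!sumd -sumrB.
by apply: eq_bigr => j _; rewrite !mxE !andbT mulrBl.
Qed.

Lemma Bmx_skew B : (Bmx B)^T = - Bmx B.
Proof.
apply/matrixP => i j; rewrite !mxE !andbT.
case: i => [[|[|[|//]]] hi]; case: j => [[|[|[|//]]] hj];
  rewrite !eqE /= ?mul0r ?mul1r ?subr0 ?sub0r ?oppr0 ?opprK //;
  try congr (- _); congr (B _ _); exact/val_inj.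
Qed.

Lemma tauB_normal tau B : tauB tau B \is normalmx.
Proof.
have skew : (tauB tau B) ^t* = - tauB tau B.
  apply/matrixP => i j; rewrite !mxE /=.
  have := congr1 (fun M : 'M[R]_3 => M i j) (Bmx_skew B).
  by rewrite !mxE => ->; rewrite mulrN; apply/eqP; rewrite eq_complex /= oppr0 !eqxx.
by apply/normalmxP; rewrite skew mulmxN mulNmx.
Qed.

End MagneticField.

Record filters (R : realType) := Filters {
  psi_m : R[i] -> R[i]; psi_p : R[i] -> R[i];
  chi_m : R[i] -> R[i]; chi_p : R[i] -> R[i];
  phi_m : R[i] -> R[i]; phi_p : R[i] -> R[i] }.

Section Integrator.
Variable R : realType.
Variables (F : filters R).

Definition Phi0 (z : R[i]) : R[i] := varphi1 z - (phi_p F z + phi_m F z) / 2.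

Definition Psi0 (z : R[i]) : R[i] :=
  sinch (z / 2) - (psi_m F z + psi_p F z * cexp z) / 2 * cexp (- (z / 2)).

Variables (tau : R) (B : 'cV[R]_3).
Let A := tauB tau B.

Definition Smx : 'M[R[i]]_(3 + 3) :=
  2^-1 *: block_mx ((tau / 2)%:C *: mxfun (chi_m F) A)
                   ((tau / 2)%:C *: mxfun (chi_p F) A)
                   (mxfun (phi_m F) A) (mxfun (phi_p F) A).

(* One step [(q, v) -> (q', v')] of the integrator. The relations are written
   in C^3, since nothing forces the filter matrices to be real. *)
Definition step (E : 'cV[R]_3 -> 'cV[R]_3) (q v q' v' : 'cV[R]_3) : Prop :=
  toC q' = toC q
    + (tau / 2)%:C *: (mxfun (psi_m F) A *m toC v + mxfun (psi_p F) A *m toC v')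
    + (tau ^+ 2 / 4)%:C *: (mxfun (chi_m F) A *m toC (E q)
                            + mxfun (chi_p F) A *m toC (E q'))
  /\
  toC v' = mxfun (@cexp R) A *m toC v
    + (tau / 2)%:C *: (mxfun (phi_m F) A *m toC (E q)
                       + mxfun (phi_p F) A *m toC (E q')).

End Integrator.

(* On [0, T]: continuity up to the end points, the equations inside. *)
Definition is_solution (R : realType) (B : 'cV[R]_3)
    (E : 'cV[R]_3 -> 'cV[R]_3) (T : R) (q0 v0 : 'cV[R]_3)
    (q v : R -> 'cV[R]_3) :=
  [/\ q 0 = q0, v 0 = v0,
      {within `[0, T], continuous q}, {within `[0, T], continuous v} &
      forall t, 0 < t < T ->
        is_derive t (1 : R) q (v t) /\
        is_derive t (1 : R) v (crossv (v t) B + E (q t))].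

(* Main.v *)
Require Import Defs.
From mathcomp Require Import all_boot all_order all_algebra.
From mathcomp Require Import all_classical all_reals all_analysis.
From mathcomp Require Import complex.
From mathcomp Require Import ring lra.
Import Order.TTheory GRing.Theory Num.Theory.
Import numFieldNormedType.Exports.
Local Open Scope classical_set_scope.
Local Open Scope complex_scope.
Local Open Scope sesquilinear_scope.
Local Open Scope ring_scope.

Set Implicit Arguments.
Unset Strict Implicit.
Unset Printing Implicit Defensive.

(** The error bound is the usual combination of local errors of size [O(tau^2)]
    and a stable error recursion; the point is that no constant depends on the
    strength of the magnetic field, although the frequencies [|B|] of the linear
    part are unbounded.

    Local errors. The matrix [tau B] is real and skew-symmetric, hence unitarily
    diagonalisable with purely imaginary eigenvalues. In a spectral coordinate
    the motion reads [r' = w] and [w' = i om w + g], where [g] is a coordinate of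
    the electric force. In the rotating frame the term [i om w] disappears, and
    plain mean value inequalities give, uniformly in [om],
      - [w(a + tau) = e^{i om tau} w(a) + tau varphi1(i om tau) g(a) + O(tau^2)],
        because [g] varies by [O(tau)] ([duhamel_frozen_force]);
      - [r(a + tau) = r(a) + tau varphi1(i om tau) w(a) + O(tau^2)], because [w]
        deviates from free gyration by [O(tau)] ([phase_primitive]).
    The condition [Phi0 = 0] says [phi_- + phi_+ = 2 varphi1], and [Psi0 = 0] says
    [psi_- + psi_+ e^z = 2 varphi1] on the spectrum ([filter_phi], [filter_psi]),
    so the integrator reproduces both right-hand sides up to [O(tau^2)].

    Stability. Eliminating the new velocity from the position update, the
    propagation of the errors is governed by the isometry [e^{tau B}] and by
    [tau varphi1(tau B)], which is [O(tau)]; the field differences enter through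
    [tau S] and, once more, through [tau / 2 psi_+ tau S]. Lipschitz continuity of
    [E] therefore gives ([position_error_step], [velocity_error_step])
      [a' <= a + tau K (a + a') + 2 tau b + D tau^2],
      [b' <= b + tau K (a + a') + D tau^2]
    for the norms [a], [b] of the position and velocity errors, with
    [K = (2 + T) C_S L_E]. The stepsize restriction bounds [tau K] away from [1],
    so the implicit term can be absorbed and a discrete Gronwall argument
    concludes ([implicit_recursion]). *)

Local Notation normc := ComplexField.Normc.normc.

(** * Euclidean norms and the operator norm *)

Section VectorNorms.
Variable R : realType.

Lemma normcE_sqr (z : R[i]) : normc z ^+ 2 = complex.Re z ^+ 2 + complex.Im z ^+ 2.
Proof. by case: z => a b /=; rewrite sqr_sqrtr // addr_ge0 ?sqr_ge0. Qed.

Lemma normc_ge0 (z : R[i]) : 0 <= normc z.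
Proof. by case: z => a b; exact: sqrtr_ge0. Qed.

Lemma normc_real (a : R) : normc a%:C = `|a|.
Proof. by rewrite /= expr0n addr0 sqrtr_sqr. Qed.

Lemma normc_Re (z : R[i]) : `|complex.Re z| <= normc z.
Proof.
rewrite -(ler_pXn2r (n := 2)) ?nnegrE ?normc_ge0 // normcE_sqr.
by rewrite real_normK ?num_real// lerDl sqr_ge0.
Qed.

Lemma normc_Im (z : R[i]) : `|complex.Im z| <= normc z.
Proof.
rewrite -(ler_pXn2r (n := 2)) ?nnegrE ?normc_ge0 // normcE_sqr.
by rewrite real_normK ?num_real// lerDr sqr_ge0.
Qed.

Lemma normc_le_ReIm (z : R[i]) : normc z <= `|complex.Re z| + `|complex.Im z|.
Proof.
rewrite -(ler_pXn2r (n := 2)) ?nnegrE ?normc_ge0 ?addr_ge0// normcE_sqr.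
rewrite sqrrD !real_normK ?num_real//.
by rewrite addrAC lerDl mulrn_wge0// mulr_ge0.
Qed.

Lemma normcD (z w : R[i]) : normc (z + w) <= normc z + normc w.
Proof. exact: le_normcD. Qed.

Lemma normc_sum I (r : seq I) (F : I -> R[i]) :
  normc (\sum_(i <- r) F i) <= \sum_(i <- r) normc (F i).
Proof.
elim/big_ind2: _ => //; first by rewrite ComplexField.Normc.normc0.
by move=> x1 x2 y1 y2 h1 h2; apply: le_trans (normcD _ _) (lerD _ _).
Qed.

Section Minkowski.
Variables (I : finType).
Implicit Types a b : I -> R.

Let nrm a := Num.sqrt (\sum_i a i ^+ 2).

Lemma sumsqr_ge0 a : 0 <= \sum_i a i ^+ 2.
Proof. by apply: sumr_ge0 => i _; exact: sqr_ge0. Qed.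

(** Expanding the nonnegative sum of [(|b| a_i - |a| b_i)^2] gives the inequality
    multiplied by [2 |a| |b|]; the degenerate case is treated apart because that
    factor then vanishes. *)
Lemma sum_cauchy_schwarz a b : \sum_i a i * b i <= nrm a * nrm b.
Proof.
have [ab0|abN0] := eqVneq (nrm a * nrm b) 0.
  have null c : nrm c = 0 -> forall i, c i = 0.
    move=> /eqP; rewrite sqrtr_eq0 => c0 i.
    have /eqP : \sum_i c i ^+ 2 = 0 by apply/le_anti; rewrite c0 sumsqr_ge0.
    rewrite psumr_eq0 => [/allP /(_ i)|j _]; last exact: sqr_ge0.
    by rewrite mem_index_enum sqrf_eq0 => /(_ isT) /eqP.
  rewrite big1 ?ab0// => i _.
  by move/eqP: ab0; rewrite mulf_eq0 => /orP[] /eqP /null ->; rewrite ?mul0r ?mulr0.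
have ab_gt0 : 0 < nrm a * nrm b by rewrite lt_neqAle eq_sym abN0 mulr_ge0 ?sqrtr_ge0.
have sq c : \sum_i c i ^+ 2 = nrm c ^+ 2 by rewrite sqr_sqrtr ?sumsqr_ge0.
have : 0 <= \sum_i (nrm b * a i - nrm a * b i) ^+ 2 by exact: sumsqr_ge0.
rewrite (_ : \sum_i _ =
  nrm b ^+ 2 * (\sum_i a i ^+ 2) + nrm a ^+ 2 * (\sum_i b i ^+ 2)
  - 2 * (nrm a * nrm b) * (\sum_i a i * b i)); last first.
  rewrite !mulr_sumr -big_split/= -sumrB; apply: eq_bigr => i _; ring.
rewrite !sq subr_ge0 (_ : _ + _ = 2 * (nrm a * nrm b) * (nrm a * nrm b)); last by ring.
by rewrite ler_pM2l// mulr_gt0.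
Qed.

Lemma minkowski2 a b : nrm (fun i => a i + b i) <= nrm a + nrm b.
Proof.
rewrite -(ler_pXn2r (n := 2)) ?nnegrE ?addr_ge0 ?sqrtr_ge0//.
rewrite sqrrD !sqr_sqrtr ?sumsqr_ge0//.
rewrite (_ : \sum_i _ = \sum_i a i ^+ 2 + \sum_i b i ^+ 2 + 2 * \sum_i a i * b i); last first.
  rewrite mulr_sumr -!big_split/=; apply: eq_bigr => i _; ring.
rewrite addrAC lerD2r lerD2l -[leRHS]mulr_natl ler_pM2l//.
exact: sum_cauchy_schwarz.
Qed.

End Minkowski.

Section ComplexVectors.
Variables (n : nat).
Implicit Types x y : 'cV[R[i]]_n.

Lemma cl2norm_ge0 x : 0 <= cl2norm x. Proof. exact: sqrtr_ge0. Qed.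

Lemma cl2norm0 : cl2norm (0 : 'cV[R[i]]_n) = 0.
Proof.
rewrite /cl2norm big1 ?sqrtr0// => i _.
by rewrite mxE ComplexField.Normc.normc0 expr0n.
Qed.

Lemma cl2normD x y : cl2norm (x + y) <= cl2norm x + cl2norm y.
Proof.
apply: le_trans (minkowski2 _ _); rewrite ler_wsqrtr//; apply: ler_sum => i _.
by rewrite ler_pXn2r ?nnegrE ?addr_ge0 ?normc_ge0// mxE normcD.
Qed.

Lemma cl2normZ (c : R[i]) x : cl2norm (c *: x) = normc c * cl2norm x.
Proof.
rewrite /cl2norm -[normc c]ger0_norm ?normc_ge0// -sqrtr_sqr -sqrtrM ?sqr_ge0//.
congr Num.sqrt; rewrite mulr_sumr; apply: eq_bigr => i _.
by rewrite mxE ComplexField.Normc.normcM exprMn.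
Qed.

Lemma cl2normZr (c : R) x : 0 <= c -> cl2norm (c%:C *: x) = c * cl2norm x.
Proof. by move=> c0; rewrite cl2normZ normc_real ger0_norm. Qed.

Lemma cl2normN x : cl2norm (- x) = cl2norm x.
Proof.
by rewrite -scaleN1r cl2normZ (normcN 1) ComplexField.Normc.normc1 mul1r.
Qed.

Lemma cl2normB x y : cl2norm (x - y) <= cl2norm x + cl2norm y.
Proof. by rewrite -(cl2normN y) cl2normD. Qed.

Lemma normc_le_cl2norm x i : normc (x i 0) <= cl2norm x.
Proof.
rewrite -(ler_pXn2r (n := 2)) ?nnegrE ?normc_ge0 ?cl2norm_ge0//.
rewrite sqr_sqrtr ?sumsqr_ge0// (bigD1 i)//= lerDl.
by apply: sumr_ge0 => j _; exact: sqr_ge0.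
Qed.

Lemma cl2norm_eq0 x : cl2norm x = 0 -> x = 0.
Proof.
move=> x0; apply/colP => i; rewrite mxE; apply: ComplexField.Normc.eq0_normc.
by apply/le_anti; rewrite normc_ge0 -x0 normc_le_cl2norm.
Qed.

Lemma cl2norm_le_sum x : cl2norm x <= \sum_i normc (x i 0).
Proof.
have s0 : 0 <= \sum_i normc (x i 0) by apply: sumr_ge0 => i _; exact: normc_ge0.
rewrite -(ler_pXn2r (n := 2)) ?nnegrE ?cl2norm_ge0//.
rewrite sqr_sqrtr ?sumsqr_ge0// expr2 mulr_suml; apply: ler_sum => i _.
rewrite expr2 ler_wpM2l ?normc_ge0// (bigD1 i)//= lerDl.
by apply: sumr_ge0 => j _; exact: normc_ge0.
Qed.

Lemma cl2norm_le_bound (m : R) x : (forall i, normc (x i 0) <= m) -> cl2norm x <= n%:R * m.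
Proof.
move=> xm; apply: le_trans (cl2norm_le_sum x) _.
apply: (le_trans (ler_sum _ (fun i _ => xm i))).
by rewrite sumr_const card_ord mulr_natl.
Qed.

End ComplexVectors.

Lemma cl2norm_toC n (x : 'cV[R]_n) : cl2norm (toC x) = l2norm x.
Proof.
congr Num.sqrt; apply: eq_bigr => i _.
by rewrite mxE normc_real real_normK ?num_real.
Qed.

Lemma sqr_cl2norm_col_mx m n (x : 'cV[R[i]]_m) (y : 'cV[R[i]]_n) :
  cl2norm (col_mx x y) ^+ 2 = cl2norm x ^+ 2 + cl2norm y ^+ 2.
Proof.
rewrite !sqr_sqrtr ?sumsqr_ge0// big_split_ord/=; congr (_ + _);
  by apply: eq_bigr => i _; rewrite ?col_mxEu ?col_mxEd.
Qed.

Lemma cl2norm_col_mx_ge m n (x : 'cV[R[i]]_m) (y : 'cV[R[i]]_n) :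
  (cl2norm x <= cl2norm (col_mx x y)) /\ (cl2norm y <= cl2norm (col_mx x y)).
Proof.
by split; rewrite -(ler_pXn2r (n := 2)) ?nnegrE ?cl2norm_ge0// sqr_cl2norm_col_mx
  ?lerDl ?lerDr sqr_ge0.
Qed.

Lemma cl2norm_col_mx_le m n (x : 'cV[R[i]]_m) (y : 'cV[R[i]]_n) :
  cl2norm (col_mx x y) <= cl2norm x + cl2norm y.
Proof.
rewrite -(ler_pXn2r (n := 2)) ?nnegrE ?addr_ge0 ?cl2norm_ge0// sqr_cl2norm_col_mx.
by rewrite sqrrD addrAC lerDl mulrn_wge0// mulr_ge0 ?cl2norm_ge0.
Qed.

(** A supremum over an unbounded set would be the default value [0], so
    [opnorm] means nothing before boundedness is known; the sum of the moduli of
    the entries is a crude bound. *)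
Lemma opnorm_has_sup m n (A : 'M[R[i]]_(m, n)) :
  has_sup [set cl2norm (A *m x) | x in [set x : 'cV[R[i]]_n | cl2norm x <= 1]].
Proof.
split; first by exists (cl2norm (A *m 0)), 0 => //=; rewrite cl2norm0.
exists (\sum_i \sum_j normc (A i j)) => _ [x /= x1 <-].
apply: le_trans (cl2norm_le_sum _) _; apply: ler_sum => i _; rewrite mxE.
apply: le_trans (normc_sum _ _) _; apply: ler_sum => j _.
rewrite ComplexField.Normc.normcM ler_piMr ?normc_ge0//.
exact: le_trans (normc_le_cl2norm _ _) x1.
Qed.

Lemma opnorm_ge0 m n (A : 'M[R[i]]_(m, n)) : 0 <= opnorm A.
Proof.
apply: le_trans (cl2norm_ge0 (A *m 0)) _; apply: sup_upper_bound.
  exact: opnorm_has_sup.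
by exists 0 => //=; rewrite cl2norm0.
Qed.

Lemma opnorm_mulmx m n (A : 'M[R[i]]_(m, n)) (x : 'cV[R[i]]_n) :
  cl2norm (A *m x) <= opnorm A * cl2norm x.
Proof.
have [x0|xN0] := eqVneq (cl2norm x) 0.
  by rewrite (cl2norm_eq0 x0) mulmx0 !cl2norm0 mulr0.
have x_gt0 : 0 < cl2norm x by rewrite lt_neqAle eq_sym xN0 cl2norm_ge0.
have i_ge0 : 0 <= (cl2norm x)^-1 by rewrite invr_ge0 ltW.
rewrite -ler_pdivrMr// mulrC -(cl2normZr _ i_ge0) scalemxAr.
apply: sup_upper_bound; first exact: opnorm_has_sup.
by exists ((cl2norm x)^-1%:C *: x) => //=; rewrite cl2normZr// mulVf.
Qed.

Lemma opnorm_le_mulmx m n (A : 'M[R[i]]_(m, n)) (c : R) (x : 'cV[R[i]]_n) :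
  opnorm A <= c -> cl2norm (A *m x) <= c * cl2norm x.
Proof.
move=> Ac; apply: le_trans (opnorm_mulmx A x) _.
by rewrite ler_wpM2r ?cl2norm_ge0.
Qed.

End VectorNorms.

(** * Functions of normal matrices in spectral coordinates *)

Section MatrixFunctions.
Variables (C : numClosedFieldType) (n : nat) (A : 'M[C]_n).
Implicit Types f g : C -> C.

Let P := spectralmx A.
Let d := spectral_diag A.

Lemma mxfunD f g : mxfun (fun z => f z + g z) A = mxfun f A + mxfun g A.
Proof.
rewrite /mxfun -mulmxDl -mulmxDr -linearD/=; congr (_ *m diag_mx _ *m _).
by apply/rowP => j; rewrite !mxE.
Qed.

Lemma mxfunM f g : mxfun (fun z => f z * g z) A = mxfun f A *m mxfun g A.
Proof.
rewrite /mxfun !mulmxA mulmxK ?spectral_unit// -(mulmxA _ (diag_mx _) (diag_mx _)) mulmx_diag.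
congr (_ *m diag_mx _ *m _).
by apply/rowP => j; rewrite !mxE.
Qed.

Lemma mxfunZ (c : C) f : mxfun (fun z => c * f z) A = c *: mxfun f A.
Proof.
rewrite /mxfun scalemxAl scalemxAr -linearZ/=; congr (_ *m diag_mx _ *m _).
by apply/rowP => j; rewrite !mxE.
Qed.

(** In spectral coordinates a matrix function is diagonal: vector identities and
    estimates involving functions of [A] reduce to scalar ones. *)
Lemma spectral_mxfunE f (x : 'cV[C]_n) j :
  (P *m (mxfun f A *m x)) j 0 = f (d 0 j) * (P *m x) j 0.
Proof.
rewrite !mulmxA mulmxV ?spectral_unit// mul1mx -mulmxA.
by rewrite mul_diag_mx !mxE.
Qed.

Lemma eq_mxfun f g : (forall j, f (d 0 j) = g (d 0 j)) -> mxfun f A = mxfun g A.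
Proof.
move=> fg; rewrite /mxfun; congr (_ *m diag_mx _ *m _).
by apply/rowP => j; rewrite !mxE fg.
Qed.

Hypothesis A_normal : A \is normalmx.

Lemma spectral_mulE : P *m A = diag_mx d *m P.
Proof.
by rewrite [in LHS](orthomx_spectralP A_normal) !mulmxA mulmxV ?spectral_unit// mul1mx.
Qed.

Lemma spectral_mulmxE (x : 'cV[C]_n) j :
  (P *m (A *m x)) j 0 = d 0 j * (P *m x) j 0.
Proof. by rewrite mulmxA spectral_mulE -mulmxA mul_diag_mx mxE. Qed.

(** The rows of [P] are left eigenvectors, nonzero because [P] is invertible. *)
Lemma eigenvalue_spectral_diag j : eigenvalue A (d 0 j).
Proof.
apply/eigenvalueP; exists (row j P).
  by rewrite -row_mul spectral_mulE mul_diag_mx; apply/rowP => k; rewrite !mxE.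
apply/negP => /eqP rj0.
have /(congr1 (row j)) : P *m invmx P = 1%:M by rewrite mulmxV ?spectral_unit.
rewrite row_mul rj0 mul0mx => /rowP /(_ j); rewrite !mxE eqxx => /eqP.
by rewrite eq_sym oner_eq0.
Qed.

(** Conjugate-transposing [P A P^* = diag d] conjugates the diagonal factor. *)
Lemma skew_spectral_diag : A ^t* = - A -> forall j, (d 0 j)^* = - d 0 j.
Proof.
move=> skew j.
have PA : P *m A *m P ^t* = diag_mx d.
  by rewrite spectral_mulE -mulmxA (unitarymxP _) ?spectral_unitarymx// mulmx1.
have := congr1 (fun M : 'M[C]_n => (M ^t*) j j) PA.
rewrite !trmx_mul !map_mxM trmxCK skew mulNmx mulmxN mulmxA PA !mxE eqxx mulr1n.
by move=> ->.
Qed.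

End MatrixFunctions.

Section ComplexMatrixFunctions.
Variable R : realType.
Variables (n : nat) (A : 'M[R[i]]_n).

(** [spectralmx A] is unitary. *)
Lemma cl2norm_spectral (x : 'cV[R[i]]_n) : cl2norm (spectralmx A *m x) = cl2norm x.
Proof.
have dot (y : 'cV[R[i]]_n) : (cl2norm y ^+ 2)%:C = (y ^t* *m y) 0 0.
  rewrite sqr_sqrtr ?sumsqr_ge0// mxE rmorph_sum/=; apply: eq_bigr => i _.
  by rewrite !mxE mulrC -sqr_normc -rmorphXn; case: (y i 0).
apply: (@pexpIrn _ 2 isT); rewrite ?nnegrE ?cl2norm_ge0//.
apply: (complexI (R := R)); rewrite !dot trmx_mul map_mxM -mulmxA (mulmxA ((spectralmx A)^t*)).
by rewrite -invmx_unitary ?spectral_unitarymx// mulVmx ?spectral_unit// mul1mx.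
Qed.

Lemma cl2norm_mxfun_le f (m : R) (x : 'cV[R[i]]_n) : 0 <= m ->
  (forall j, normc (f (spectral_diag A 0 j)) <= m) ->
  cl2norm (mxfun f A *m x) <= m * cl2norm x.
Proof.
move=> m0 fm; rewrite -[leLHS]cl2norm_spectral -[in leRHS]cl2norm_spectral.
rewrite -(cl2normZr _ m0) ler_wsqrtr//; apply: ler_sum => j _.
rewrite ler_pXn2r ?nnegrE ?normc_ge0// spectral_mxfunE [in leRHS]mxE.
by rewrite !ComplexField.Normc.normcM normc_real ger0_norm// ler_wpM2r ?normc_ge0.
Qed.

Lemma cl2norm_le_spectral (m : R) (x : 'cV[R[i]]_n) :
  (forall j, normc ((spectralmx A *m x) j 0) <= m) -> cl2norm x <= n%:R * m.
Proof. by move=> xm; rewrite -cl2norm_spectral; exact: cl2norm_le_bound. Qed.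

End ComplexMatrixFunctions.

Lemma tauB_eigen_imaginary (R : realType) (tau : R) B j :
  complex.Re (spectral_diag (tauB tau B) 0 j) = 0.
Proof.
have skew : (tauB tau B) ^t* = - tauB tau B.
  apply/matrixP => k l; rewrite !mxE /=.
  have := congr1 (fun M : 'M[R]_3 => M k l) (Bmx_skew B).
  by rewrite !mxE => ->; rewrite mulrN; apply/eqP; rewrite eq_complex /= oppr0 !eqxx.
have := skew_spectral_diag (tauB_normal tau B) skew j.
by case: (spectral_diag _ _ _) => a b [] /= /eqP; lra.
Qed.

(** * Oscillatory scalar equations *)

Section ComplexCurves.
Variable R : realType.
Implicit Types (f g w r : R -> R[i]) (a b t M om : R) (z l : R[i]).

Lemma complex_ReD z l : complex.Re (z + l) = complex.Re z + complex.Re l.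
Proof. by case: z; case: l. Qed.

Lemma complex_ImD z l : complex.Im (z + l) = complex.Im z + complex.Im l.
Proof. by case: z; case: l. Qed.

Lemma complex_ReM z l : complex.Re (z * l)
  = complex.Re z * complex.Re l - complex.Im z * complex.Im l.
Proof. by case: z; case: l. Qed.

Lemma complex_ImM z l : complex.Im (z * l)
  = complex.Re z * complex.Im l + complex.Im z * complex.Re l.
Proof. by case: z; case: l. Qed.

(** Differentiation of complex-valued curves of a real variable, split into real
    and imaginary parts, since these are what the real mean value theorem handles. *)
Definition cderiv f t l :=
  is_derive t (1 : R) (fun s => complex.Re (f s)) (complex.Re l) /\
  is_derive t (1 : R) (fun s => complex.Im (f s)) (complex.Im l).

Definition ccont a b f :=
  {within `[a, b], continuous (fun s => complex.Re (f s))} /\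
  {within `[a, b], continuous (fun s => complex.Im (f s))}.

Lemma cderiv_cst l t : cderiv (fun _ => l) t 0.
Proof. by split; exact: is_derive_cst. Qed.

Lemma cderivB f g t l z : cderiv f t l -> cderiv g t z ->
  cderiv (fun s => f s - g s) t (l - z).
Proof.
move=> [f1 f2] [g1 g2]; split; rewrite raddfB/=.
  rewrite (_ : (fun _ => _) = (fun s => complex.Re (f s)) - (fun s => complex.Re (g s))).
    exact: is_deriveB.
  by apply/funext => s; rewrite raddfB.
rewrite (_ : (fun _ => _) = (fun s => complex.Im (f s)) - (fun s => complex.Im (g s))).
  exact: is_deriveB.
by apply/funext => s; rewrite raddfB.
Qed.

Lemma cderivM f g t l z : cderiv f t l -> cderiv g t z ->
  cderiv (fun s => f s * g s) t (l * g t + f t * z).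
Proof.
move=> [f1 f2] [g1 g2]; split.
  rewrite (_ : (fun _ => _) =
    (fun s => complex.Re (f s)) * (fun s => complex.Re (g s))
    - (fun s => complex.Im (f s)) * (fun s => complex.Im (g s))); last first.
    by apply/funext => s; rewrite complex_ReM.
  apply: is_derive_eq (is_deriveB (is_deriveM f1 g1) (is_deriveM f2 g2)) _.
  rewrite complex_ReD !complex_ReM /GRing.scale/=; ring.
rewrite (_ : (fun _ => _) =
  (fun s => complex.Re (f s)) * (fun s => complex.Im (g s))
  + (fun s => complex.Im (f s)) * (fun s => complex.Re (g s))); last first.
  by apply/funext => s; rewrite complex_ImM.
apply: is_derive_eq (is_deriveD (is_deriveM f1 g2) (is_deriveM f2 g1)) _.
rewrite complex_ImD !complex_ImM /GRing.scale/=; ring.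
Qed.

Lemma cderiv_ccont f a b (f' : R -> R[i]) :
  (forall t, cderiv f t (f' t)) -> ccont a b f.
Proof.
move=> df; split; apply: continuous_subspaceT => t;
  apply/differentiable_continuous/derivable1_diffP.
  by case: (df t).1.
by case: (df t).2.
Qed.

Lemma ccont_cst l a b : ccont a b (fun _ => l).
Proof. by apply: (@cderiv_ccont _ _ _ (fun=> 0)) => t; exact: cderiv_cst. Qed.

Lemma ccontB f g a b : ccont a b f -> ccont a b g -> ccont a b (fun s => f s - g s).
Proof.
move=> [f1 f2] [g1 g2]; split.
  rewrite (_ : (fun _ => _) = (fun s => complex.Re (f s)) - (fun s => complex.Re (g s))).
    by move=> x; apply: continuousB; [exact: f1|exact: g1].
  by apply/funext => s; rewrite raddfB.
rewrite (_ : (fun _ => _) = (fun s => complex.Im (f s)) - (fun s => complex.Im (g s))).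
  by move=> x; apply: continuousB; [exact: f2|exact: g2].
by apply/funext => s; rewrite raddfB.
Qed.

Lemma ccontM f g a b : ccont a b f -> ccont a b g -> ccont a b (fun s => f s * g s).
Proof.
move=> [f1 f2] [g1 g2]; split.
  rewrite (_ : (fun _ => _) =
    (fun s => complex.Re (f s)) * (fun s => complex.Re (g s))
    - (fun s => complex.Im (f s)) * (fun s => complex.Im (g s))).
    by move=> x; apply: continuousB; apply: continuousM;
      [exact: f1|exact: g1|exact: f2|exact: g2].
  by apply/funext => s; rewrite complex_ReM.
rewrite (_ : (fun _ => _) =
  (fun s => complex.Re (f s)) * (fun s => complex.Im (g s))
  + (fun s => complex.Im (f s)) * (fun s => complex.Re (g s))).
  by move=> x; apply: continuousD; apply: continuousM;
    [exact: f1|exact: g2|exact: f2|exact: g1].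
by apply/funext => s; rewrite complex_ImM.
Qed.

Lemma ccont_sub f a b c d : a <= c -> d <= b -> ccont a b f -> ccont c d f.
Proof.
by move=> ac db [f1 f2]; split; [move: f1|move: f2]; apply: continuous_subspaceW;
  apply: subset_itv; rewrite bnd_simp.
Qed.

(** The mean value theorem applies to the real and the imaginary part separately,
    at two different points; this costs the factor [2]. *)
Lemma complex_mvt f (f' : R -> R[i]) a b M : a <= b -> ccont a b f ->
  (forall t, a < t < b -> cderiv f t (f' t)) ->
  (forall t, a < t < b -> normc (f' t) <= M) ->
  normc (f b - f a) <= 2 * M * (b - a).
Proof.
move=> ab [cf1 cf2] df fM.
have [ab_eq|aNb] := eqVneq a b.
  by rewrite ab_eq !subrr ComplexField.Normc.normc0 mulr0.
have {aNb}ab : a < b by rewrite lt_neqAle aNb.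
have ba : 0 <= b - a by rewrite subr_ge0 ltW.
have in_ab t : t \in `]a, b[ -> a < t < b by rewrite in_itv.
have [c /in_ab cab Ec] := MVT ab (fun t h => (df t (in_ab t h)).1) cf1.
have [d /in_ab dab Ed] := MVT ab (fun t h => (df t (in_ab t h)).2) cf2.
apply: le_trans (normc_le_ReIm _) _; rewrite !raddfB/= Ec Ed !normrM (ger0_norm ba).
rewrite -mulrDl ler_wpM2r// mulr_natl mulr2n lerD//.
  exact: le_trans (normc_Re _) (fM _ cab).
exact: le_trans (normc_Im _) (fM _ dab).
Qed.

Definition cis (x : R) : R[i] := cos x +i* sin x.

Lemma normc_cis x : normc (cis x) = 1.
Proof. by rewrite /= cos2Dsin2 sqrtr1. Qed.

Lemma cis0 : cis 0 = 1.
Proof. by rewrite /cis cos0 sin0. Qed.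

Lemma cisD x y : cis (x + y) = cis x * cis y.
Proof.
rewrite /cis cosD sinD; apply/eqP; rewrite eq_complex /= eqxx /=; apply/eqP; ring.
Qed.

Lemma cisN x : cis (- x) * cis x = 1.
Proof. by rewrite -cisD addNr cis0. Qed.

Lemma cexp_imaginary x : cexp (0 +i* x) = cis x.
Proof. by rewrite /cexp /= expR0 mul1r. Qed.

(** [cisint om s] is [s * varphi1 (i om s)], the primitive [int_0^s exp (i om x) dx];
    the closed form has to treat [om = 0] separately. *)
Definition cisint om (s : R) : R[i] :=
  if om == 0 then s%:C else (sin (om * s) / om) +i* ((1 - cos (om * s)) / om).

Lemma cisint0 om : cisint om 0 = 0.
Proof.
rewrite /cisint; case: eqP => // _.
by rewrite mulr0 sin0 cos0 subrr !mul0r.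
Qed.

Lemma cis_cisint om s : cis (om * s) = 1 + (0 +i* om) * cisint om s.
Proof.
rewrite /cisint; case: eqP => [->|/eqP om0].
  by rewrite mul0r cis0 /= mul0r addr0.
apply/eqP; rewrite eq_complex /=; apply/andP; split; apply/eqP; field; exact: om0.
Qed.

Lemma is_derive_affine om a t : is_derive t (1 : R) (fun s => om * (s - a)) om.
Proof.
rewrite (_ : (fun _ => _) = om \*: (id - cst a)) //.
by apply: is_derive_eq; rewrite subr0 /GRing.scale/= mulr1.
Qed.

Lemma is_derive_cos_affine om a t :
  is_derive t (1 : R) (fun s => cos (om * (s - a))) (- sin (om * (t - a)) * om).
Proof.
exact: (@is_derive1_comp _ (@cos R) (fun s => om * (s - a)) t _ _
  (is_derive_cos _) (is_derive_affine om a t)).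
Qed.

Lemma is_derive_sin_affine om a t :
  is_derive t (1 : R) (fun s => sin (om * (s - a))) (cos (om * (t - a)) * om).
Proof.
exact: (@is_derive1_comp _ (@sin R) (fun s => om * (s - a)) t _ _
  (is_derive_sin _) (is_derive_affine om a t)).
Qed.

Lemma cderiv_cis om a t :
  cderiv (fun s => cis (om * (s - a))) t ((0 +i* om) * cis (om * (t - a))).
Proof.
split => /=.
  by apply: is_derive_eq (is_derive_cos_affine _ _ _) _; rewrite mul0r sub0r mulNr mulrC.
by apply: is_derive_eq (is_derive_sin_affine _ _ _) _; rewrite mul0r add0r mulrC.
Qed.

Lemma cderiv_cisint om a t :
  cderiv (fun s => cisint om (s - a)) t (cis (om * (t - a))).
Proof.
rewrite /cisint /cderiv; case: eqP => [->|/eqP om0] /=.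
  rewrite mul0r cos0 sin0; split; last exact: is_derive_cst.
  rewrite (_ : (fun _ => _) = (fun s => 1 * (s - a))); first exact: is_derive_affine.
  by apply/funext => s; rewrite mul1r.
split.
  rewrite (_ : (fun _ => _) = om^-1 \*: (fun s => sin (om * (s - a)))); last first.
    by apply/funext => s; rewrite mulrC.
  apply: is_derive_eq (is_deriveZ _ (is_derive_sin_affine _ _ _)) _.
  by rewrite /GRing.scale/= mulrCA mulVf// mulr1.
rewrite (_ : (fun _ => _) = om^-1 \*: (cst 1 - (fun s => cos (om * (s - a))))); last first.
  by apply/funext => s; rewrite mulrC.
apply: is_derive_eq (is_deriveZ _ (is_deriveB (is_derive_cst _ _ _) (is_derive_cos_affine _ _ _))) _.
by rewrite /GRing.scale/= sub0r mulNr opprK mulrCA mulVf// mulr1.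
Qed.

Lemma normc_cisint_le om s : 0 <= s -> normc (cisint om s) <= 2 * s.
Proof.
move=> s0; have := @complex_mvt (fun x => cisint om (x - 0)) (fun x => cis (om * (x - 0))) 0 s 1 s0.
rewrite !subr0 cisint0 subr0 mulr1; apply.
- by apply: cderiv_ccont => t; exact: cderiv_cisint.
- by move=> t _; exact: cderiv_cisint.
- by move=> t _; rewrite normc_cis.
Qed.

(** In the rotating frame [exp (- i om (t - a)) * w t] the stiff term [i om w]
    disappears and the derivative has the modulus of [g]: the bound is
    independent of [om]. It says that [w] deviates from free gyration by
    [O(b - a)]. *)
Lemma phase_mvt om w g a b M : a <= b -> ccont a b w ->
  (forall t, a < t < b -> cderiv w t ((0 +i* om) * w t + g t)) ->
  (forall t, a < t < b -> normc (g t) <= M) ->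
  normc (w b - cis (om * (b - a)) * w a) <= 2 * M * (b - a).
Proof.
move=> ab cw dw gM.
pose rot t := cis (- om * (t - a)).
have drot t : cderiv rot t ((0 +i* - om) * rot t) by exact: cderiv_cis.
have rota : rot a = 1 by rewrite /rot subrr mulr0 cis0.
have mvt : normc (rot b * w b - rot a * w a) <= 2 * M * (b - a).
  apply: (@complex_mvt (fun t => rot t * w t) (fun t => rot t * g t)) => //.
  - by apply: ccontM cw; apply: cderiv_ccont drot.
  - move=> t tab; have := cderivM (drot t) (dw t tab).
    congr cderiv; rewrite (_ : 0 +i* - om = - (0 +i* om)); first by ring.
    by apply/eqP; rewrite eq_complex /= oppr0 !eqxx.
  - move=> t tab; rewrite ComplexField.Normc.normcM normc_cis mul1r; exact: gM.
rewrite (_ : w b - _ = cis (om * (b - a)) * (rot b * w b - rot a * w a)).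
  by rewrite ComplexField.Normc.normcM normc_cis mul1r.
by rewrite rota mul1r [RHS]mulrBr mulrA [cis _ * rot b]mulrC /rot mulNr cisN mul1r.
Qed.

(** Variation of constants with the forcing frozen at the left end point. Since
    [y t := w t - cisint om (t - a) * g a] satisfies [y' = i om y + (g - g a)] and
    [y a = w a], the estimate for [y] only sees the variation of the forcing. *)
Lemma duhamel_frozen_force om w g a b M : a <= b -> ccont a b w ->
  (forall t, a < t < b -> cderiv w t ((0 +i* om) * w t + g t)) ->
  (forall t, a < t < b -> normc (g t - g a) <= M) ->
  normc (w b - cis (om * (b - a)) * w a - cisint om (b - a) * g a)
    <= 2 * M * (b - a).
Proof.
move=> ab cw dw gM.
pose y t := w t - cisint om (t - a) * g a.
have ya : y a = w a by rewrite /y subrr cisint0 mul0r subr0.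
rewrite addrAC -/(y b) -ya; apply: (@phase_mvt om y (fun t => g t - g a)) => //.
- apply: ccontB => //; apply: ccontM; last exact: ccont_cst.
  by apply: cderiv_ccont => t; exact: cderiv_cisint.
- move=> t tab.
  have := cderivB (dw t tab) (cderivM (cderiv_cisint om a t) (cderiv_cst (g a) t)).
  by congr cderiv; rewrite /y cis_cisint; ring.
Qed.

(** The derivative of [r t - cisint om (t - a) * w a] is the deviation of [w] from
    free gyration, which is [O(t - a)] by [phase_mvt]; integrating it gains a
    second factor [b - a]. *)
Lemma phase_primitive om r w g a b M : 0 <= M -> a <= b -> ccont a b r -> ccont a b w ->
  (forall t, a < t < b -> cderiv r t (w t)) ->
  (forall t, a < t < b -> cderiv w t ((0 +i* om) * w t + g t)) ->
  (forall t, a < t < b -> normc (g t) <= M) ->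
  normc (r b - r a - cisint om (b - a) * w a) <= 4 * M * (b - a) ^+ 2.
Proof.
move=> M0 ab cr cw dr dw gM.
pose y t := r t - cisint om (t - a) * w a.
have ya : y a = r a by rewrite /y subrr cisint0 mul0r subr0.
rewrite (_ : 4 * M * _ = 2 * (2 * M * (b - a)) * (b - a)); last by ring.
rewrite addrAC -/(y b) -ya.
apply: (@complex_mvt y (fun t => w t - cis (om * (t - a)) * w a)) => //.
- apply: ccontB => //; apply: ccontM; last exact: ccont_cst.
  by apply: cderiv_ccont => t; exact: cderiv_cisint.
- move=> t tab.
  have := cderivB (dr t tab) (cderivM (cderiv_cisint om a t) (cderiv_cst (w a) t)).
  by congr cderiv; ring.
- move=> t /andP[at_ tb].
  apply: (@le_trans _ _ (2 * M * (t - a))).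
    apply: (@phase_mvt om w g a t M (ltW at_)).
    + by apply: ccont_sub cw; rewrite // ltW.
    + by move=> s /andP[as_ st]; apply: dw; rewrite as_ (lt_trans st).
    + by move=> s /andP[as_ st]; apply: gM; rewrite as_ (lt_trans st).
  by rewrite ler_wpM2l ?mulr_ge0// lerD2r ltW.
Qed.

End ComplexCurves.

(** * Filter identities on the imaginary axis *)

Section FilterIdentities.
Variable R : realType.
Implicit Types (th om tau : R).

Lemma Rintegral01_FTC (F f : R -> R) : continuous f ->
  (forall x : R, is_derive x (1 : R) F (f x)) ->
  \int[lebesgue_measure]_(s in `[0%R, 1%R]) f s = F 1 - F 0.
Proof.
move=> cf dF.
have cF : continuous F.
  by move=> x; apply/differentiable_continuous/derivable1_diffP; case: (dF x).
rewrite /Rintegral (@continuous_FTC2 _ f F)//=.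
- exact: continuous_subspaceT.
- split; last 2 first.
  + by apply: cvg_at_right_filter; exact: cF.
  + by apply: cvg_at_left_filter; exact: cF.
  + by move=> x _; case: (dF x).
- by move=> x _; rewrite derive1E; case: (dF x).
Qed.

(** With the frequency [- th] and the base point [1], [cisint] is a primitive of
    the integrand [exp ((1 - s) i th)] that vanishes at [s = 1]. *)
Lemma varphi1_imaginary th : varphi1 (0 +i* th) = cisint th 1.
Proof.
have E s : cexp ((1 - s)%:C * (0 +i* th)) = cis (- th * (s - 1)).
  rewrite -cexp_imaginary; congr cexp; apply/eqP; rewrite eq_complex /=.
  by apply/andP; split; apply/eqP; ring.
have dcis t := cderiv_cis (- th) 1 t.
have ccis (h : R -> R) (h' : R -> R) : (forall t, is_derive t (1 : R) h (h' t)) ->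
    continuous h.
  by move=> dh x; apply/differentiable_continuous/derivable1_diffP; case: (dh x).
pose P s := cisint (- th) (s - 1).
have dP t := cderiv_cisint (- th) 1 t.
have P1 : P 1 = 0 by rewrite /P subrr cisint0.
have P0 : P 0 = - cisint th 1.
  rewrite /P sub0r /cisint oppr_eq0; case: eqP => [_|/eqP th0].
    by rewrite raddfN.
  apply/eqP; rewrite eq_complex /= mulrNN !mulr1 !invrN !mulrN !eqxx//.
rewrite /varphi1 (_ : cisint th 1 = complex.Re (P 1 - P 0) +i* complex.Im (P 1 - P 0)).
  rewrite !raddfB/=; congr (_ +i* _).
    rewrite -(Rintegral01_FTC _ (fun t => (dP t).1)) /=; last first.
      exact: ccis (fun t => (dcis t).1).
    by apply: eq_Rintegral => s _; exact: (congr1 (@complex.Re R) (E s)).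
  rewrite -(Rintegral01_FTC _ (fun t => (dP t).2)) /=; last first.
    exact: ccis (fun t => (dcis t).2).
  by apply: eq_Rintegral => s _; exact: (congr1 (@complex.Im R) (E s)).
by rewrite P1 P0 sub0r opprK; case: (cisint th 1).
Qed.

Lemma cisint_scale tau om : 0 < tau -> tau%:C * cisint (tau * om) 1 = cisint om tau.
Proof.
move=> tau0; rewrite /cisint mulf_eq0 gt_eqF//=; case: eqP => [_|/eqP om0].
  by rewrite mulr1.
rewrite mulr1 (mulrC tau); apply/eqP; rewrite eq_complex /=.
by apply/andP; split; apply/eqP; field; rewrite om0 gt_eqF.
Qed.

Lemma half_imaginary th : (0 +i* th) / 2 = 0 +i* (th / 2) :> R[i].
Proof.
apply: (mulIf (x := 2)); first by rewrite pnatr_eq0.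
rewrite divfK ?pnatr_eq0// mulr_natr mulr2n; apply/eqP; rewrite eq_complex /= addr0 eqxx/=.
by apply/eqP; field.
Qed.

(** [sinch (z / 2) e^{z / 2} = (e^z - 1) / z], which is [varphi1 z]. *)
Lemma sinch_varphi1 th : sinch ((0 +i* th) / 2) * cexp ((0 +i* th) / 2)
  = varphi1 (0 +i* th).
Proof.
rewrite varphi1_imaginary half_imaginary /sinch.
have [->|th0] := eqVneq th 0.
  by rewrite mul0r eqxx cexp_imaginary cis0 mul1r /cisint eqxx.
have z0 (x : R) : x != 0 -> 0 +i* x != 0 :> R[i].
  by apply: contraNneq => -[->].
have thh : th / 2 != 0 by rewrite mulf_neq0// invr_eq0 pnatr_eq0.
rewrite (negbTE (z0 _ thh)).
have -> : - (0 +i* (th / 2)) = 0 +i* - (th / 2) :> R[i].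
  by apply/eqP; rewrite eq_complex /= oppr0 !eqxx.
rewrite !cexp_imaginary -half_imaginary.
have c2 : cis (th / 2) * cis (th / 2) = 1 + (0 +i* th) * cisint th 1.
  by rewrite -cisD -cis_cisint; congr cis; field.
rewrite mulrAC -[X in X / _]mulrA [_^-1 * _]mulrC mulrA mulrBl c2 cisN.
by rewrite addrAC subrr add0r; field; exact: z0.
Qed.

(** The condition [Psi0 = 0] multiplied by [e^{z / 2}]: on a free gyration the
    filtered trapezoidal rule for [q' = v] is exact. *)
Lemma filter_psi (F : filters R) th : Psi0 F (0 +i* th) = 0 ->
  psi_m F (0 +i* th) + psi_p F (0 +i* th) * cexp (0 +i* th) = 2 * varphi1 (0 +i* th).
Proof.
rewrite /Psi0 => /eqP; rewrite subr_eq0 => /eqP E.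
rewrite -sinch_varphi1 E half_imaginary.
have -> : - (0 +i* (th / 2)) = 0 +i* - (th / 2) :> R[i].
  by apply/eqP; rewrite eq_complex /= oppr0 !eqxx.
rewrite !(cexp_imaginary (_ / 2)) !(cexp_imaginary (- _)) -mulrA cisN mulr1.
by rewrite [RHS]mulrC divfK// pnatr_eq0.
Qed.

(** The velocity filters integrate a constant force exactly. *)
Lemma filter_phi (F : filters R) z : Phi0 F z = 0 ->
  phi_m F z + phi_p F z = 2 * varphi1 z.
Proof.
rewrite /Phi0 => /eqP; rewrite subr_eq0 => /eqP ->.
by rewrite addrC [RHS]mulrC divfK// pnatr_eq0.
Qed.

End FilterIdentities.

(** * Local errors of the exact solution *)

Lemma colB (V : zmodType) n (x y : 'cV[V]_n) j : (x - y) j 0 = x j 0 - y j 0.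
Proof. by rewrite !mxE. Qed.

Lemma colZ (K : pzRingType) n (c : K) (x : 'cV[K]_n) j : (c *: x) j 0 = c * x j 0.
Proof. by rewrite mxE. Qed.

Section Coordinates.
Variable R : realType.
Variables (m n : nat) (P : 'M[R[i]]_(m, n)).
Implicit Types (x : R -> 'cV[R]_n).

Lemma toCB k l (x y : 'M[R]_(k, l)) : toC (x - y) = toC x - toC y.
Proof. exact: map_mxB. Qed.

Lemma toCD k l (x y : 'M[R]_(k, l)) : toC (x + y) = toC x + toC y.
Proof. exact: map_mxD. Qed.

Lemma within_continuous_sum (I : finType) (h : I -> R -> R) (D : set R) :
  (forall k, {within D, continuous (h k)}) -> {within D, continuous (\sum_k h k)}.
Proof.
move=> ch; elim/big_rec: _ => [|k f _ cf]; first by move=> t; exact: cst_continuous.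
by move=> t; apply: continuousD; [exact: ch|exact: cf].
Qed.

Lemma Re_coord (y : 'cV[R]_n) j :
  complex.Re ((P *m toC y) j 0) = \sum_k complex.Re (P j k) * y k 0.
Proof.
rewrite mxE raddf_sum/=; apply: eq_bigr => k _.
by rewrite complex_ReM mxE /= mulr0 subr0.
Qed.

Lemma Im_coord (y : 'cV[R]_n) j :
  complex.Im ((P *m toC y) j 0) = \sum_k complex.Im (P j k) * y k 0.
Proof.
rewrite mxE raddf_sum/=; apply: eq_bigr => k _.
by rewrite complex_ImM mxE /= mulr0 add0r.
Qed.

Lemma coord_ccont x a b j : {within `[a, b], continuous x} ->
  ccont a b (fun t => (P *m toC (x t)) j 0).
Proof.
move=> cx.
have cxk (c : R) k : {within `[a, b], continuous (cst c * (fun t => x t k 0))}.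
  move=> t; apply: continuousM; first exact: cst_continuous.
  have := @continuous_comp (subspace `[a, b]) 'cV[R]_n R x (fun M : 'cV[R]_n => M k 0) t.
  apply; first exact: cx.
  exact: coord_continuous.
split.
  rewrite (_ : (fun _ => _) = \sum_k (cst (complex.Re (P j k)) * (fun t => x t k 0))).
    exact: within_continuous_sum.
  by apply/funext => t; rewrite Re_coord fct_sumE.
rewrite (_ : (fun _ => _) = \sum_k (cst (complex.Im (P j k)) * (fun t => x t k 0))).
  exact: within_continuous_sum.
by apply/funext => t; rewrite Im_coord fct_sumE.
Qed.

Lemma is_derive_coord x t (y : 'cV[R]_n) k : is_derive t (1 : R) x y ->
  is_derive t (1 : R) (fun s => x s k 0) (y k 0).
Proof.
move=> [dx <-]; apply: DeriveDef; first exact: ((derivable_mxP x t 1).1 dx).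
by rewrite derive_mx// mxE.
Qed.

Lemma coord_cderiv x t (y : 'cV[R]_n) j : is_derive t (1 : R) x y ->
  cderiv (fun s => (P *m toC (x s)) j 0) t ((P *m toC y) j 0).
Proof.
move=> dx.
have dxk (c : R) k : is_derive t (1 : R) (c \*: (fun s => x s k 0)) (c * y k 0).
  by apply: is_deriveZ; exact: is_derive_coord.
split.
  rewrite (_ : (fun _ => _) = \sum_k (complex.Re (P j k) \*: (fun t => x t k 0))).
    by rewrite Re_coord; exact: is_derive_sum.
  by apply/funext => s; rewrite Re_coord fct_sumE.
rewrite (_ : (fun _ => _) = \sum_k (complex.Im (P j k) \*: (fun t => x t k 0))).
  by rewrite Im_coord; exact: is_derive_sum.
by apply/funext => s; rewrite Im_coord fct_sumE.
Qed.

End Coordinates.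

Lemma l2norm_mvt (R : realType) n (x x' : R -> 'cV[R]_n) (a b M : R) : a <= b ->
  {within `[a, b], continuous x} ->
  (forall t, a < t < b -> is_derive t (1 : R) x (x' t)) ->
  (forall t, a < t < b -> l2norm (x' t) <= M) ->
  l2norm (x b - x a) <= n%:R * (2 * M * (b - a)).
Proof.
move=> ab cx dx xM; rewrite -cl2norm_toC; apply: cl2norm_le_bound => j.
rewrite toCB -[_ - _]mul1mx mulmxBr colB.
apply: (@complex_mvt _ (fun s => (1%:M *m toC (x s)) j 0)
  (fun s => (1%:M *m toC (x' s)) j 0)) => //.
- exact: coord_ccont.
- by move=> t tab; apply: coord_cderiv; exact: dx.
- move=> t tab; apply: le_trans (xM _ tab).
  by rewrite mul1mx -cl2norm_toC; exact: normc_le_cl2norm.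
Qed.

Lemma tauB_mulmx (R : realType) (tau : R) B (y : 'cV[R[i]]_3) :
  tauB tau B *m y = tau%:C *: (toC (Bmx B) *m y).
Proof. by rewrite /tauB /toC map_mxZ scalemxAl. Qed.

Section LocalDefects.
Variable R : realType.
Variables (B : 'cV[R]_3) (E : 'cV[R]_3 -> 'cV[R]_3) (q v : R -> 'cV[R]_3).
Variables (tau a L ME MV : R).
Hypotheses (tau_gt0 : 0 < tau) (L_ge0 : 0 <= L) (ME_ge0 : 0 <= ME) (MV_ge0 : 0 <= MV).
Hypothesis E_lip : l2lipschitz L E.
Let b := a + tau.
Hypotheses (cq : {within `[a, b], continuous q}) (cv : {within `[a, b], continuous v}).
Hypothesis dq : forall t, a < t < b -> is_derive t (1 : R) q (v t).
Hypothesis dv : forall t, a < t < b -> is_derive t (1 : R) v (crossv (v t) B + E (q t)).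
Hypothesis v_le : forall t, a <= t <= b -> l2norm (v t) <= MV.
Hypothesis E_le : forall t, a <= t <= b -> l2norm (E (q t)) <= ME.

Let A := tauB tau B.
Let P := spectralmx A.
Let om j := complex.Im (spectral_diag A 0 j) / tau.

Let ab : a <= b. Proof. by rewrite /b lerDl ltW. Qed.
Let ba : b - a = tau. Proof. by rewrite /b addrC addKr. Qed.
Let tauN0 : tau != 0. Proof. by rewrite gt_eqF. Qed.

Let eigenE j : spectral_diag A 0 j = 0 +i* (tau * om j).
Proof.
by apply/eqP; rewrite eq_complex tauB_eigen_imaginary /= eqxx /= /om mulrC divfK.
Qed.

Let cexp_eigen j : cexp (spectral_diag A 0 j) = cis (om j * tau).
Proof. by rewrite eigenE cexp_imaginary mulrC. Qed.

Let varphi1_eigen j : tau%:C * varphi1 (spectral_diag A 0 j) = cisint (om j) tau.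
Proof. by rewrite eigenE varphi1_imaginary cisint_scale. Qed.

Let coord_le (x : 'cV[R]_3) j : normc ((P *m toC x) j 0) <= l2norm x.
Proof. by apply: le_trans (normc_le_cl2norm _ _) _; rewrite cl2norm_spectral cl2norm_toC. Qed.

Let inab t : a < t < b -> a <= t <= b.
Proof. by case/andP => *; rewrite !ltW. Qed.

Let dqj j t (tab : a < t < b) := coord_cderiv P j (dq tab).

Let dvj j t : a < t < b -> cderiv (fun s => (P *m toC (v s)) j 0) t
  ((0 +i* om j) * (P *m toC (v t)) j 0 + (P *m toC (E (q t))) j 0).
Proof.
move=> tab; have := coord_cderiv P j (dv tab); congr cderiv.
rewrite toCD mulmxDr mxE; congr (_ + _).
have tC : tau%:C != 0 :> R[i] by apply: contra tauN0 => /eqP [->].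
apply: (mulfI tC).
rewrite mulrA (_ : tau%:C * (0 +i* om j) = spectral_diag A 0 j); last first.
  by rewrite eigenE; apply/eqP; rewrite eq_complex /=; apply/andP; split; apply/eqP; ring.
rewrite -(spectral_mulmxE (tauB_normal tau B)) -BmxE tauB_mulmx -scalemxAr [RHS]mxE.
by rewrite [toC (Bmx B *m _)]map_mxM.
Qed.

Lemma position_drift t : a <= t <= b -> l2norm (q t - q a) <= 6 * MV * (t - a).
Proof.
move=> /andP[at_ tb]; rewrite (_ : 6 * MV * _ = 3%:R * (2 * MV * (t - a))); last by ring.
apply: (@l2norm_mvt _ _ _ v) => //.
- by move: cq; apply: continuous_subspaceW; apply: subset_itv; rewrite bnd_simp.
- by move=> s /andP[as_ st]; apply: dq; rewrite as_ (lt_le_trans st).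
- by move=> s /andP[as_ st]; apply: v_le; rewrite !ltW// (lt_le_trans st).
Qed.

Let Efield_drift t : a <= t <= b ->
  l2norm (E (q t) - E (q a)) <= L * (6 * MV * (t - a)).
Proof.
by move=> tab; apply: le_trans (E_lip _ _) _; rewrite ler_wpM2l// position_drift.
Qed.

(** Each spectral coordinate of [v] satisfies [w' = i om w + g] with [g] the
    corresponding coordinate of the force, so [duhamel_frozen_force] applies. The
    constant collects [3] coordinates, [2] for the complex mean value inequality
    and the drift [6 MV tau] of the position; the frequencies do not enter. *)
Lemma velocity_defect :
  cl2norm (toC (v b) - mxfun (@cexp R) A *m toC (v a)
           - tau%:C *: (mxfun (@varphi1 R) A *m toC (E (q a))))
    <= 36 * L * MV * tau ^+ 2.
Proof.
rewrite (_ : 36 * L * MV * _ = 3%:R * (2 * (L * (6 * MV * tau)) * tau)); last by ring.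
apply: (@cl2norm_le_spectral _ _ A) => j; rewrite -/P !mulmxBr -scalemxAr.
rewrite !colB colZ !spectral_mxfunE (mulrA tau%:C) varphi1_eigen cexp_eigen -ba.
apply: (@duhamel_frozen_force _ (om j) (fun t => (P *m toC (v t)) j 0)
  (fun t => (P *m toC (E (q t))) j 0)) => //.
- exact: coord_ccont.
- exact: dvj.
- move=> t tab.
  rewrite -colB -mulmxBr -toCB.
  apply: le_trans (coord_le _ _) _; apply: le_trans (Efield_drift (inab tab)) _.
  rewrite ler_wpM2l// ler_wpM2l ?mulr_ge0// lerD2r.
  by case/andP: tab => _ /ltW.
Qed.

Lemma velocity_increment :
  cl2norm (toC (v b) - mxfun (@cexp R) A *m toC (v a)) <= 6 * ME * tau.
Proof.
rewrite (_ : 6 * ME * _ = 3%:R * (2 * ME * tau)); last by ring.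
apply: (@cl2norm_le_spectral _ _ A) => j; rewrite -/P !mulmxBr.
rewrite colB spectral_mxfunE cexp_eigen -ba.
apply: (@phase_mvt _ (om j) (fun t => (P *m toC (v t)) j 0)
  (fun t => (P *m toC (E (q t))) j 0)) => //.
- exact: coord_ccont.
- exact: dvj.
- by move=> t tab; apply: le_trans (coord_le _ _) _; apply: E_le; exact: inab.
Qed.

Lemma position_defect :
  cl2norm (toC (q b) - toC (q a) - tau%:C *: (mxfun (@varphi1 R) A *m toC (v a)))
    <= 12 * ME * tau ^+ 2.
Proof.
rewrite (_ : 12 * ME * _ = 3%:R * (4 * ME * tau ^+ 2)); last by ring.
apply: (@cl2norm_le_spectral _ _ A) => j; rewrite -/P !mulmxBr -scalemxAr.
rewrite !colB colZ spectral_mxfunE (mulrA tau%:C) varphi1_eigen -ba.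
apply: (@phase_primitive _ (om j) (fun t => (P *m toC (q t)) j 0)
  (fun t => (P *m toC (v t)) j 0) (fun t => (P *m toC (E (q t))) j 0)) => //.
- exact: coord_ccont.
- exact: coord_ccont.
- exact: dqj.
- exact: dvj.
- by move=> t tab; apply: le_trans (coord_le _ _) _; apply: E_le; exact: inab.
Qed.

End LocalDefects.

(** * Error recursions *)

Section ErrorRecursion.
Variable R : realType.

(** The bound [s n <= D tau (n tau) e^{M n tau}] propagates because
    [1 + tau M <= e^{M tau}]. *)
Lemma gronwall_discrete (T tau M D : R) (s : nat -> R) :
  0 < tau -> 0 <= M -> 0 <= D -> s 0%N = 0 ->
  (forall n, 0 <= s n) ->
  (forall n : nat, n.+1%:R * tau <= T ->
     s n.+1 <= (1 + tau * M) * s n + D * tau ^+ 2) ->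
  forall n : nat, n%:R * tau <= T -> s n <= D * T * expR (M * T) * tau.
Proof.
move=> tau0 M0 D0 s0 s_ge0 rec.
have H n : n%:R * tau <= T ->
    s n <= D * tau * (n%:R * tau) * expR (M * (n%:R * tau)).
  elim: n => [|n IH] nT; first by rewrite s0 !mul0r !mulr0 mul0r.
  have nT' : n%:R * tau <= T.
    by apply: le_trans nT; rewrite ler_pM2r// ler_nat.
  apply: le_trans (rec _ nT) _.
  have E1 : 1 + tau * M <= expR (M * tau) by rewrite mulrC expR_ge1Dx.
  have E2 : 1 <= expR (M * (n.+1%:R * tau)).
    rewrite -[leLHS]expR0 ler_expR; apply: mulr_ge0 => //.
    by apply: mulr_ge0 => //; exact: ltW.
  apply: (@le_trans _ _ (expR (M * tau) * (D * tau * (n%:R * tau) * expR (M * (n%:R * tau)))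
      + D * tau ^+ 2 * expR (M * (n.+1%:R * tau)))).
    apply: lerD.
      apply: ler_pM => //; last exact: IH.
      by rewrite addr_ge0// mulr_ge0// ltW.
    by rewrite ler_peMr// mulr_ge0// sqr_ge0.
  have -> : expR (M * (n.+1%:R * tau)) = expR (M * tau) * expR (M * (n%:R * tau)).
    by rewrite -expRD; congr expR; rewrite -natr1; ring.
  by rewrite le_eqVlt; apply/orP; left; apply/eqP; rewrite -natr1; ring.
move=> n nT; apply: le_trans (H n nT) _.
have nt0 : 0 <= n%:R * tau by rewrite mulr_ge0// ltW.
rewrite (_ : D * T * expR (M * T) * tau = D * tau * T * expR (M * T)); last by ring.
have Dt : 0 <= D * tau by rewrite mulr_ge0// ltW.
apply: ler_pM; [exact: mulr_ge0|exact: expR_ge0|exact: ler_wpM2l|].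
by rewrite ler_expR ler_wpM2l.
Qed.

(** [beta] is the amplification in the crude bound of the implicit term, the
    exponential the Gronwall factor. *)
Definition error_const (T K kappa D : R) : R :=
  let beta := (1 - kappa)^-1 in
  (2 * K * beta * D * T + 2 * D) * T
    * expR ((2 * K + 2 * K * beta * (2 + 2 * T) + 2) * T).

(** The recursion is implicit, since [a n.+1] is on both sides. First [tau K <= kappa]
    only yields a crude bound of [a n.+1] by a multiple of [a n + b n + tau];
    the implicit term carries a further factor [tau], so inserting the crude
    bound there leaves an explicit recursion with amplification [1 + O(tau)].
    Dividing by [1 - kappa] at once would lose that. *)
Lemma implicit_recursion (T tau K kappa D : R) (a b : nat -> R) :
  0 < T -> 0 < tau -> 0 <= K -> 0 <= D -> tau * K <= kappa -> kappa < 1 ->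
  (forall n, 0 <= a n) -> (forall n, 0 <= b n) -> a 0%N = 0 -> b 0%N = 0 ->
  (forall n : nat, n.+1%:R * tau <= T ->
     a n.+1 <= a n + tau * K * (a n + a n.+1) + 2 * tau * b n + D * tau ^+ 2) ->
  (forall n : nat, n.+1%:R * tau <= T ->
     b n.+1 <= b n + tau * K * (a n + a n.+1) + D * tau ^+ 2) ->
  forall n : nat, n%:R * tau <= T ->
    a n + b n <= error_const T K kappa D * tau.
Proof.
move=> T0 tau0 K0 D0 tK k1 a_ge0 b_ge0 a0 b0 ra rb.
rewrite /error_const; set beta := (1 - kappa)^-1.
have beta0 : 0 <= beta by rewrite invr_ge0 subr_ge0 ltW.
apply: (gronwall_discrete (s := fun n => a n + b n)) => //.
- by rewrite !addr_ge0// !mulr_ge0// ?addr_ge0// ?mulr_ge0// ltW.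
- by rewrite !addr_ge0// !mulr_ge0// ltW.
- by rewrite a0 b0 addr0.
- by move=> n; exact: addr_ge0.
move=> n nT.
have tT : tau <= T.
  by apply: le_trans nT; rewrite ler_peMl ?ler1n// ltW.
have tK0 : 0 <= tau * K by rewrite mulr_ge0// ltW.
have a'_le : a n.+1 <= beta * ((2 + 2 * T) * (a n + b n) + D * T * tau).
  rewrite mulrC ler_pdivlMr ?subr_gt0//.
  have := ra n nT.
  have h1 : tau * K * a n <= kappa * a n by exact: ler_wpM2r.
  have h2 : tau * K * a n.+1 <= kappa * a n.+1 by exact: ler_wpM2r.
  have h3 : tau * b n <= T * b n by exact: ler_wpM2r.
  have h4 : D * tau * tau <= D * tau * T by rewrite ler_wpM2l// mulr_ge0// ltW.
  have h5 : kappa * a n <= a n by rewrite ler_piMl// ltW.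
  have h6 : 0 <= T * a n by rewrite mulr_ge0// ltW.
  have := b_ge0 n; rewrite expr2.
  by move: h1 h2 h3 h4 h5 h6; lra.
have h := ler_wpM2l tK0 a'_le.
have hb : 0 <= tau * a n by rewrite mulr_ge0// ltW.
by move: (ra n nT) (rb n nT) h hb; have hb' := ler_wpM2l tK0 (b_ge0 n); nra.
Qed.

End ErrorRecursion.

(** One step, abstractly: [Ex] and [P1] stand for [e^{tau B}] and
    [varphi1 (tau B)], capital vectors for the exact solution and lower-case ones
    for the numerical solution, primes for the new time level, and [e], [f] for
    the electric field along the exact and the numerical solution. *)
Section OneStep.
Variable R : realType.
Variables (n : nat) (tau : R) (Ex P1 psim psip chim chip phim phip : 'M[R[i]]_n).
Variables (S : 'M[R[i]]_(n + n)).
Hypothesis tau_gt0 : 0 < tau.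
Hypothesis phiE : phim + phip = 2 *: P1.
Hypothesis psiE : psim + psip *m Ex = 2 *: P1.
Hypothesis SE : S = 2^-1 *: block_mx ((tau / 2)%:C *: chim) ((tau / 2)%:C *: chip) phim phip.

Variables (Q V Q' V' e e' : 'cV[R[i]]_n) (q v q' v' f f' : 'cV[R[i]]_n).
Hypothesis stepq : q' = q + (tau / 2)%:C *: (psim *m v + psip *m v')
  + (tau ^+ 2 / 4)%:C *: (chim *m f + chip *m f').
Hypothesis stepv : v' = Ex *m v + (tau / 2)%:C *: (phim *m f + phip *m f').

Let rho1 := (tau ^+ 2 / 4)%:C *: (chim *m (e - f) + chip *m (e' - f')).
Let rho2 := (tau / 2)%:C *: (phim *m (e - f) + phip *m (e' - f')).
Let dq := Q' - Q - tau%:C *: (P1 *m V)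
  - (tau / 2)%:C *: (psip *m (V' - Ex *m V))
  - (tau ^+ 2 / 4)%:C *: (chim *m e + chip *m e').
Let dv := V' - Ex *m V - tau%:C *: (P1 *m e) - (tau / 2)%:C *: (phip *m (e' - e)).

Lemma scaled_filter_block (x y : 'cV[R[i]]_n) :
  tau%:C *: (S *m col_mx x y) =
  col_mx ((tau ^+ 2 / 4)%:C *: (chim *m x + chip *m y))
         ((tau / 2)%:C *: (phim *m x + phip *m y)).
Proof.
have two : (2 : R[i]) = 2%:C by rewrite rmorph_nat.
rewrite SE -scalemxAl scalerA mul_block_col scale_col_mx -!scalemxAl -scalerDr scalerA.
congr (col_mx (_ *: _) (_ *: _)).
  by rewrite two -fmorphV -!rmorphM; congr (_%:C); field.
by rewrite two -fmorphV -!rmorphM.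
Qed.

Let tauP1 (x : 'cV[R[i]]_n) : tau%:C *: (P1 *m x) = (tau / 2)%:C *: (psim *m x + psip *m (Ex *m x)).
Proof.
have two : (2 : R[i]) = 2%:C by rewrite rmorph_nat.
rewrite mulmxA -mulmxDl psiE -scalemxAl scalerA two -rmorphM.
by congr (_%:C *: _); field.
Qed.

Let tauP1' (x : 'cV[R[i]]_n) : tau%:C *: (P1 *m x) = (tau / 2)%:C *: (phim *m x + phip *m x).
Proof.
have two : (2 : R[i]) = 2%:C by rewrite rmorph_nat.
rewrite -mulmxDl phiE -scalemxAl scalerA two -rmorphM.
by congr (_%:C *: _); field.
Qed.

(** The filter identity for [phi] turns the consistency error of a force frozen at
    the old position into [dv]. *)
Lemma velocity_error_recursion : V' - v' = Ex *m (V - v) + (rho2 + dv).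
Proof.
rewrite stepv /rho2 /dv tauP1' !mulmxBr.
set x1 := Ex *m V; set x2 := Ex *m v.
set y1 := phim *m f; set y2 := phip *m f'.
set y3 := phim *m e; set y4 := phip *m e'; set y5 := phip *m e.
set c := _%:C; clearbody x1 x2 y1 y2 y3 y4 y5 c.
by apply/colP => j; rewrite !mxE; ring.
Qed.

(** The new velocity enters the position update through [psip]; replacing it by
    [Ex *m v + (v' - Ex *m v)] and using the filter identity for [psi] leaves the
    harmless [tau P1] acting on the old velocity error, while [psip] only acts on
    the small forcing contributions [rho2 + dv]. *)
Lemma position_error_recursion :
  Q' - q' = (Q - q) + tau%:C *: (P1 *m (V - v))
    + (rho1 + (tau / 2)%:C *: (psip *m (rho2 + dv)) + dq).
Proof.
have -> : rho2 + dv = (V' - v') - Ex *m (V - v).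
  by rewrite velocity_error_recursion [RHS]addrC addKr.
rewrite stepq /rho1 /dq !tauP1 !mulmxBr.
set x1 := psim *m V; set x2 := psim *m v.
set y1 := psip *m (Ex *m V); set y2 := psip *m (Ex *m v).
set y3 := psip *m V'; set y4 := psip *m v'.
set z1 := chim *m e; set z2 := chim *m f.
set z3 := chip *m e'; set z4 := chip *m f'.
set c1 := (tau / 2)%:C; set c2 := (tau ^+ 2 / 4)%:C.
clearbody x1 x2 y1 y2 y3 y4 z1 z2 z3 z4 c1 c2.
by apply/colP => j; rewrite !mxE; ring.
Qed.

Variables (T CS CF L ME MV : R).
Hypotheses (T_ge0 : 0 <= T) (CS_ge0 : 0 <= CS) (L_ge0 : 0 <= L) (ME_ge0 : 0 <= ME).
Hypothesis S_le : opnorm S <= CS.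
Hypothesis psip_tau_le : tau * opnorm psip <= 2 * (1 + T).
Hypotheses (psip_le : opnorm psip <= CF) (chim_le : opnorm chim <= CF)
  (chip_le : opnorm chip <= CF).
Hypothesis Ex_le : forall x : 'cV[R[i]]_n, cl2norm (Ex *m x) <= cl2norm x.
Hypothesis P1_le : forall x : 'cV[R[i]]_n, cl2norm (P1 *m x) <= 2 * cl2norm x.
Hypothesis e_lip : cl2norm (e - f) <= L * cl2norm (Q - q).
Hypothesis e'_lip : cl2norm (e' - f') <= L * cl2norm (Q' - q').
Hypotheses (e_le : cl2norm e <= ME) (e'_le : cl2norm e' <= ME).
Hypothesis e_drift : cl2norm (e' - e) <= 6 * L * MV * tau.
Hypothesis V_defect :
  cl2norm (V' - Ex *m V - tau%:C *: (P1 *m e)) <= 36 * L * MV * tau ^+ 2.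
Hypothesis V_increment : cl2norm (V' - Ex *m V) <= 6 * ME * tau.
Hypothesis Q_defect :
  cl2norm (Q' - Q - tau%:C *: (P1 *m V)) <= 12 * ME * tau ^+ 2.

Let Dv := (36 + 6 * CS) * L * MV.
Let Dq := (12 + 4 * CF) * ME.

Let tau_ge0 : 0 <= tau. Proof. exact: ltW. Qed.
Let half_ge0 : 0 <= tau / 2. Proof. by rewrite divr_ge0. Qed.

Let rho_le : cl2norm (col_mx rho1 rho2)
  <= tau * (CS * L) * (cl2norm (Q - q) + cl2norm (Q' - q')).
Proof.
rewrite -scaled_filter_block cl2normZr// -!mulrA ler_wpM2l//.
apply: le_trans (opnorm_le_mulmx _ S_le) _; rewrite ler_wpM2l//.
apply: le_trans (cl2norm_col_mx_le _ _) _.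
by rewrite mulrDr lerD.
Qed.

Let rho1_le := le_trans (cl2norm_col_mx_ge rho1 rho2).1 rho_le.
Let rho2_le := le_trans (cl2norm_col_mx_ge rho1 rho2).2 rho_le.

Let dv_le : cl2norm dv <= Dv * tau ^+ 2.
Proof.
apply: le_trans (cl2normB _ _) _.
rewrite (_ : Dv * _ = 36 * L * MV * tau ^+ 2 + tau * (CS * (6 * L * MV * tau))); last first.
  by rewrite /Dv; ring.
apply: lerD V_defect _.
(* the phi_+ part of dv is the lower block of tau S applied to (0, e' - e) *)
have := (cl2norm_col_mx_ge ((tau ^+ 2 / 4)%:C *: (chim *m 0 + chip *m (e' - e)))
  ((tau / 2)%:C *: (phim *m 0 + phip *m (e' - e)))).2.
rewrite -scaled_filter_block [phim *m 0]mulmx0 add0r => /le_trans; apply; rewrite cl2normZr//.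
rewrite ler_wpM2l//; apply: le_trans (opnorm_le_mulmx _ S_le) _.
rewrite ler_wpM2l//; apply: le_trans (cl2norm_col_mx_le _ _) _.
by rewrite cl2norm0 add0r.
Qed.

Let CF_ge0 : 0 <= CF. Proof. exact: le_trans (opnorm_ge0 _) psip_le. Qed.

Let dq_le : cl2norm dq <= Dq * tau ^+ 2.
Proof.
apply: le_trans (cl2normB _ _) _.
apply: le_trans (lerD (cl2normB _ _) (lexx _)) _.
rewrite !cl2normZr ?divr_ge0 ?exprn_ge0//.
have h1 : cl2norm (psip *m (V' - Ex *m V)) <= CF * (6 * ME * tau).
  apply: le_trans (opnorm_le_mulmx _ psip_le) _; exact: ler_wpM2l.
have h2 : cl2norm (chim *m e + chip *m e') <= 2 * (CF * ME).
  apply: le_trans (cl2normD _ _) _; rewrite mulr_natl mulr2n.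
  by apply: lerD; [apply: le_trans (opnorm_le_mulmx _ chim_le) _
    |apply: le_trans (opnorm_le_mulmx _ chip_le) _]; exact: ler_wpM2l.
have t4 : 0 <= tau ^+ 2 / 4 by rewrite divr_ge0// exprn_ge0.
have := lerD (lerD Q_defect (ler_wpM2l half_ge0 h1)) (ler_wpM2l t4 h2).
move=> /le_trans; apply; rewrite /Dq.
rewrite -subr_ge0 (_ : _ - _ = 2^-1 * (CF * ME * tau ^+ 2)); last by field.
by rewrite !mulr_ge0// ?invr_ge0// exprn_ge0.
Qed.

Let psip_half_le (x : 'cV[R[i]]_n) :
  cl2norm ((tau / 2)%:C *: (psip *m x)) <= (1 + T) * cl2norm x.
Proof.
rewrite cl2normZr//.
apply: le_trans (ler_wpM2l half_ge0 (opnorm_mulmx _ _)) _.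
rewrite mulrA ler_wpM2r ?cl2norm_ge0//.
by move: psip_tau_le; lra.
Qed.

Let K := (2 + T) * (CS * L).
Let D := (2 + T) * Dv + Dq.

Let err_ge0 : 0 <= tau * (CS * L) * (cl2norm (Q - q) + cl2norm (Q' - q')).
Proof. by rewrite !mulr_ge0// addr_ge0// cl2norm_ge0. Qed.

Let Dv_ge0 : 0 <= Dv * tau ^+ 2. Proof. exact: le_trans (cl2norm_ge0 _) dv_le. Qed.
Let Dq_ge0 : 0 <= Dq * tau ^+ 2. Proof. exact: le_trans (cl2norm_ge0 _) dq_le. Qed.

Lemma velocity_error_step : cl2norm (V' - v') <= cl2norm (V - v)
  + tau * K * (cl2norm (Q - q) + cl2norm (Q' - q')) + D * tau ^+ 2.
Proof.
rewrite velocity_error_recursion.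
have := lerD (Ex_le (V - v)) (le_trans (cl2normD rho2 dv) (lerD rho2_le dv_le)).
move=> /(le_trans (cl2normD _ _)) /le_trans; apply.
rewrite /K /D -[leRHS]addrA lerD2l.
move: err_ge0 Dv_ge0 Dq_ge0.
set X := tau * (CS * L) * _ => X0; set Y := Dv * _ => Y0; set Z := Dq * _ => Z0.
rewrite (_ : tau * _ * _ = (2 + T) * X); last by rewrite /X; ring.
rewrite (_ : (_ + Dq) * _ = (2 + T) * Y + Z); last by rewrite /Y /Z; ring.
rewrite -subr_ge0 (_ : _ - _ = (1 + T) * (X + Y) + Z); last by ring.
by rewrite addr_ge0// mulr_ge0 ?addr_ge0.
Qed.

(** Of the factor [2 + T] in [K], one unit is the direct contribution [rho1] and
    [1 + T] bounds the norm of [tau / 2 psip] acting on [rho2]. *)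
Lemma position_error_step : cl2norm (Q' - q') <= cl2norm (Q - q)
  + tau * K * (cl2norm (Q - q) + cl2norm (Q' - q'))
  + 2 * tau * cl2norm (V - v) + D * tau ^+ 2.
Proof.
rewrite [in leLHS]position_error_recursion.
have hP : cl2norm (tau%:C *: (P1 *m (V - v))) <= 2 * tau * cl2norm (V - v).
  by rewrite cl2normZr// [2 * tau]mulrC -mulrA ler_wpM2l.
have h2 : cl2norm ((tau / 2)%:C *: (psip *m (rho2 + dv))) <=
    (1 + T) * (tau * (CS * L) * (cl2norm (Q - q) + cl2norm (Q' - q')) + Dv * tau ^+ 2).
  apply: le_trans (psip_half_le _) _; rewrite ler_wpM2l ?addr_ge0//.
  exact: le_trans (cl2normD _ _) (lerD rho2_le dv_le).
have := lerD (le_trans (cl2normD _ _) (lerD (lexx (cl2norm (Q - q))) hP))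
  (le_trans (cl2normD _ _) (lerD (le_trans (cl2normD _ _) (lerD rho1_le h2)) dq_le)).
move=> /(le_trans (cl2normD _ _)) /le_trans; apply.
rewrite /K /D.
move: err_ge0 Dv_ge0 Dq_ge0.
set X := tau * (CS * L) * _ => X0; set Y := Dv * _ => Y0; set Z := Dq * _ => Z0.
rewrite (_ : tau * _ * _ = (2 + T) * X); last by rewrite /X; ring.
rewrite (_ : (_ + Dq) * _ = (2 + T) * Y + Z); last by rewrite /Y /Z; ring.
by rewrite -subr_ge0 (_ : _ - _ = Y)//; ring.
Qed.

End OneStep.

(** * The global error bound *)

Lemma compact_l2norm_bounded (R : realType) (K : set 'cV[R]_3) : compact K ->
  exists2 M, 0 <= M & forall x, K x -> l2norm x <= M.
Proof.
move=> /compact_bounded /pinfty_ex_gt0 [M /ltW M0 KM].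
exists (3%:R * M); first by rewrite mulr_ge0.
move=> x Kx; rewrite -cl2norm_toC; apply: cl2norm_le_bound => i.
rewrite mxE normc_real.
apply: le_trans (KM x Kx); rewrite [leRHS]/Num.Def.normr/= mx_normrE.
exact: (le_bigmax _ (fun ij => `|x ij.1 ij.2|) (i, 0)).
Qed.

Lemma l2lipschitz_ge0 (R : realType) n (L : R) (E : 'cV[R]_n.+1 -> 'cV[R]_n.+1) :
  l2lipschitz L E -> 0 <= L.
Proof.
move=> /(_ (const_mx 1) 0); rewrite subr0 => /(le_trans (sqrtr_ge0 _)).
rewrite pmulr_lge0// sqrtr_gt0 (bigD1 ord0)//=; apply: ltr_pwDl.
  by rewrite mxE expr1n.
by apply: sumr_ge0 => i _; exact: sqr_ge0.
Qed.

Lemma l2norm_col_mx_le (R : realType) m n (x : 'cV[R]_m) (y : 'cV[R]_n) :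
  l2norm (col_mx x y) <= l2norm x + l2norm y.
Proof.
by rewrite -!cl2norm_toC [toC (col_mx _ _)]map_col_mx; exact: cl2norm_col_mx_le.
Qed.

Lemma tauB_eigenE (R : realType) (tau : R) B j :
  spectral_diag (tauB tau B) 0 j = 0 +i* complex.Im (spectral_diag (tauB tau B) 0 j).
Proof. by apply/eqP; rewrite eq_complex tauB_eigen_imaginary /= !eqxx. Qed.

Section GyroMatrices.
Variables (R : realType) (tau : R) (B : 'cV[R]_3) (F : filters R).
Let A := tauB tau B.

Lemma cl2norm_exp_tauB (x : 'cV[R[i]]_3) : cl2norm (mxfun (@cexp R) A *m x) <= cl2norm x.
Proof.
rewrite -[leRHS]mul1r; apply: cl2norm_mxfun_le => // j.
by rewrite tauB_eigenE cexp_imaginary normc_cis.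
Qed.

Lemma cl2norm_varphi1_tauB (x : 'cV[R[i]]_3) :
  cl2norm (mxfun (@varphi1 R) A *m x) <= 2 * cl2norm x.
Proof.
apply: cl2norm_mxfun_le => // j.
by rewrite tauB_eigenE varphi1_imaginary -[leRHS]mulr1 normc_cisint_le.
Qed.

Hypothesis filter0 : forall z, eigenvalue A z -> Phi0 F z = 0 /\ Psi0 F z = 0.

Lemma mxfun_phi : mxfun (phi_m F) A + mxfun (phi_p F) A = 2 *: mxfun (@varphi1 R) A.
Proof.
rewrite -mxfunD -mxfunZ; apply: eq_mxfun => j; apply: filter_phi.
by have [] := filter0 (eigenvalue_spectral_diag (tauB_normal tau B) j).
Qed.

Lemma mxfun_psi : mxfun (psi_m F) A + mxfun (psi_p F) A *m mxfun (@cexp R) A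
  = 2 *: mxfun (@varphi1 R) A.
Proof.
rewrite -mxfunM -mxfunD -mxfunZ; apply: eq_mxfun => j.
have [_] := filter0 (eigenvalue_spectral_diag (tauB_normal tau B) j).
by rewrite tauB_eigenE => /filter_psi.
Qed.

End GyroMatrices.

Theorem theorem5p4 (R : realType) (Kq Kv : set 'cV[R]_3)
    (T L_E M_E C_S C_F : R) :
  0 < T -> compact Kq -> compact Kv ->
  exists C : R,
  forall (E : 'cV[R]_3 -> 'cV[R]_3) (delta : R) (B q0 v0 : 'cV[R]_3)
         (q v : R -> 'cV[R]_3) (F : filters R) (tau : R)
         (qn vn : nat -> 'cV[R]_3),
    (* the electric field; M_E only names a bound of E on the compact Kq *)
    C1_near Kq E -> l2lipschitz L_E E ->
    (forall x, Kq x -> l2norm (E x) <= M_E) ->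
    (* the strong magnetic field and the exact solution *)
    0 < delta < 1 -> l2norm B = delta^-1 ->
    is_solution B E T q0 v0 q v ->
    (forall t, 0 <= t <= T -> Kq (q t) /\ Kv (v t)) ->
    (* the stepsize and the filter functions *)
    0 < tau ->
    2 * tau * (1 + T) * C_S * L_E < 1 ->
    opnorm (Smx F tau B) <= C_S ->
    (forall z, eigenvalue (tauB tau B) z -> Phi0 F z = 0 /\ Psi0 F z = 0) ->
    (* filter bounds which the bound on S does not provide *)
    opnorm (mxfun (psi_p F) (tauB tau B)) <= C_F ->
    opnorm (mxfun (chi_m F) (tauB tau B)) <= C_F ->
    opnorm (mxfun (chi_p F) (tauB tau B)) <= C_F ->
    tau * opnorm (mxfun (psi_p F) (tauB tau B)) <= 2 * (1 + T) ->
    (* the numerical solution *)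
    qn 0%N = q0 -> vn 0%N = v0 ->
    (forall n : nat, n.+1%:R * tau <= T ->
       step F tau B E (qn n) (vn n) (qn n.+1) (vn n.+1)) ->
    forall n : nat, n%:R * tau <= T ->
      l2norm (col_mx (q (n%:R * tau) - qn n) (v (n%:R * tau) - vn n))
        <= C * tau.
Proof.
move=> T0 _ /compact_l2norm_bounded [MV MV0 KvM].
pose K := (2 + T) * (C_S * L_E).
pose D := (2 + T) * ((36 + 6 * C_S) * L_E * MV) + (12 + 4 * C_F) * M_E.
(* [K] contains the factor [1 + (1 + T)]: the force error enters directly and
   through [tau / 2 psi_+], whose norm is at most [1 + T]. The stepsize
   restriction thus gives [tau K < kappa], and [kappa < 1] as [T > 0]. *)
pose kappa := (2 + T) / (2 * (1 + T)).
exists (error_const T K kappa D).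
move=> E delta B q0 v0 q v F tau qn vn _ E_lip E_le _ _ [qE vE cq cv sol] inK tau0
  small S_le filter0 psip_le chim_le chip_le psip_tau qn0 vn0 steps.
have T_ge0 : 0 <= T := ltW T0.
have L0 : 0 <= L_E := l2lipschitz_ge0 E_lip.
have CS0 : 0 <= C_S := le_trans (opnorm_ge0 _) S_le.
have CF0 : 0 <= C_F := le_trans (opnorm_ge0 _) psip_le.
have ME0 : 0 <= M_E.
  apply: le_trans (E_le _ (inK 0 _).1); first exact: sqrtr_ge0.
  by rewrite lexx.
have K0 : 0 <= K by rewrite !mulr_ge0// addr_ge0.
have D0 : 0 <= D by rewrite addr_ge0// !mulr_ge0// addr_ge0// mulr_ge0.
have T1 : 0 < 2 * (1 + T) by rewrite mulr_gt0// ltr_wpDr.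
have tauK : tau * K <= kappa.
  rewrite /kappa ler_pdivlMr// (_ : tau * K * _ = (2 + T) * (2 * tau * (1 + T) * C_S * L_E)).
    by rewrite ler_piMr ?ltW// ltr_wpDr.
  by rewrite /K; ring.
have kappa1 : kappa < 1 by rewrite /kappa ltr_pdivrMr// mul1r mulrDr mulr1 ltrD2l ltr_pMl// ltr1n.
pose a n := l2norm (q (n%:R * tau) - qn n).
pose b n := l2norm (v (n%:R * tau) - vn n).
have one_step n : n.+1%:R * tau <= T ->
    a n.+1 <= a n + tau * K * (a n + a n.+1) + 2 * tau * b n + D * tau ^+ 2 /\
    b n.+1 <= b n + tau * K * (a n + a n.+1) + D * tau ^+ 2.
  move=> nT; have [stepq stepv] := steps n nT.
  rewrite /a /b -!cl2norm_toC !toCB.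
  have tn1 : n.+1%:R * tau = n%:R * tau + tau by rewrite -natr1 mulrDl mul1r.
  move: nT; rewrite tn1; set t := n%:R * tau => tT.
  have t_ge0 : 0 <= t by rewrite mulr_ge0// ltW.
  have inT s : t <= s <= t + tau -> 0 <= s <= T.
    by case/andP=> ts st; rewrite (le_trans t_ge0 ts) (le_trans st tT).
  have ooT s : t < s < t + tau -> 0 < s < T.
    by case/andP=> ts st; rewrite (le_lt_trans t_ge0 ts) (lt_le_trans st tT).
  have sub : `[t, t + tau] `<=` `[0, T] by apply: subset_itv; rewrite bnd_simp.
  have cq' := continuous_subspaceW sub cq.
  have cv' := continuous_subspaceW sub cv.
  have dq s (h : t < s < t + tau) := (sol s (ooT s h)).1.
  have dv s (h : t < s < t + tau) := (sol s (ooT s h)).2.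
  have vM s (h : t <= s <= t + tau) := KvM _ (inK s (inT s h)).2.
  have EM s (h : t <= s <= t + tau) := E_le _ (inK s (inT s h)).1.
  have t_in : t <= t <= t + tau by rewrite lexx lerDl ltW.
  have t'_in : t <= t + tau <= t + tau by rewrite lexx lerDl ltW.
  have lip x y : cl2norm (toC (E x) - toC (E y)) <= L_E * cl2norm (toC x - toC y).
    by rewrite -!toCB !cl2norm_toC; exact: E_lip.
  have drift : cl2norm (toC (E (q (t + tau))) - toC (E (q t))) <= 6 * L_E * MV * tau.
    apply: le_trans (lip _ _) _; rewrite -toCB cl2norm_toC.
    have := position_drift cq' dq vM t'_in; rewrite addrAC subrr add0r => h.
    rewrite (_ : 6 * L_E * MV * tau = L_E * (6 * MV * tau)); last by ring.
    exact: ler_wpM2l.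
  have EMC s (h : t <= s <= t + tau) : cl2norm (toC (E (q s))) <= M_E.
    by rewrite cl2norm_toC; exact: EM.
  have hv := velocity_defect tau0 L0 MV0 E_lip cq' cv' dq dv vM.
  have hi := velocity_increment tau0 cv' dv EM.
  have hq := position_defect tau0 ME0 cq' cv' dq dv EM.
  split.
    exact: (position_error_step tau0 (mxfun_phi filter0) (mxfun_psi filter0) (erefl _)
      stepq stepv T_ge0 CS0 L0 ME0 S_le psip_tau psip_le chim_le chip_le
      (@cl2norm_varphi1_tauB _ tau B)
      (lip _ _) (lip _ _) (EMC _ t_in) (EMC _ t'_in) drift hv hi hq).
  exact: (velocity_error_step tau0 (mxfun_phi filter0) (erefl _)
      stepv T_ge0 CS0 L0 ME0 S_le psip_le chim_le chip_le
      (@cl2norm_exp_tauB _ tau B)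
      (lip _ _) (lip _ _) (EMC _ t_in) (EMC _ t'_in) drift hv hi hq).
move=> n nT; apply: le_trans (l2norm_col_mx_le _ _) _.
apply: (@implicit_recursion R T tau K kappa D a b) => //.
- by move=> k; exact: sqrtr_ge0.
- by move=> k; exact: sqrtr_ge0.
- by rewrite /a mul0r qE qn0 subrr -cl2norm_toC [toC 0]map_mx0 cl2norm0.
- by rewrite /b mul0r vE vn0 subrr -cl2norm_toC [toC 0]map_mx0 cl2norm0.
- by move=> k /one_step [].
- by move=> k /one_step [].
Qed.
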